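(* Let $R$ be a ring and $S=R[X_1,\ldots,X_n]$ a polynomial ring over $R$. Then a Veronese subring of $S$ is $n$-subperfect if and only if $R$ is perfect.
   Context: All rings are commutative with identity. A Veronese subring of $S=R[X_1,\ldots,X_n]$ is an $R$-subalgebra of $S$ generated by all monomials of degree $d$ in $X_1,\ldots,X_n$ for some fixed $d>0$. A ring is perfect if every flat module over it is projective (equivalently, it satisfies the descending chain condition on principal ideals). $Q(A)$ denotes the total quotient ring of a ring $A$, and $A$ is subperfect if $Q(A)$ is perfect. A sequence $x_1,\ldots,x_i$ in $A$ is a regular sequence if $(x_1,\ldots,x_i)A\neq A$ and each $x_j$ is a non-zero-divisor on $A/(x_1,\ldots,x_{j-1})A$; the empty sequence is considered a regular sequence. A ring $A$ is regularly subperfect if for each regular sequence $x_1,\ldots,x_i$ in $A$ (including the empty one) the ring $A/(x_1,\ldots,x_i)A$ is subperfect. For an integer $n\ge 0$, $A$ is $n$-subperfect if $A$ is regularly subperfect and every maximal regular sequence in $A$ has length $n$.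
   Formalization: ''n-subperfect'' here also requires that every regular sequence extends to a maximal one (else R=k[X_1,X_2,...], which has no maximal regular sequences, is a counterexample), and R is assumed nonzero (the zero ring fails for n≥1). *)

(* Defs.v *)
From HB Require Import structures.
From mathcomp Require Import all_boot all_order all_algebra.
From mathcomp Require Import boolp mpoly.

Set Implicit Arguments.
Unset Strict Implicit.
Unset Printing Implicit Defensive.

Import GRing.Theory.

Local Open Scope ring_scope.
Local Open Scope quotient_scope.

(* Conventions. The predicates below are stated for every comPzRingType, so
   that they apply to quotient rings without carrying a proof that 1 <> 0; the
   base ring R of the polynomial ring is nonzero (comNzRingType).
   mathcomp modules and rings carry a choice structure; classically every type
   has one (gen_choiceMixin), so this is no restriction. Decidable predicates
   are obtained from propositions with `[< _ >]. *)

Definition bilinear_map (R : pzRingType) (M N P : lmodType R)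
    (b : M -> N -> P) : Prop :=
  (forall n : N, linear (fun m => b m n)) /\ (forall m : M, linear (b m)).

Definition is_tensor_product (R : pzRingType) (M N T : lmodType R)
    (tau : M -> N -> T) : Prop :=
  bilinear_map tau /\
  forall (P : lmodType R) (b : M -> N -> P), bilinear_map b ->
    exists h : {linear T -> P}, (forall m n, h (tau m n) = b m n) /\
    forall h' : {linear T -> P}, (forall m n, h' (tau m n) = b m n) -> h' =1 h.

(* Tensor products are taken up to isomorphism, through their universal
   property: f_M below is the map induced by f on N (x) M -> N' (x) M. *)
Definition flat (R : pzRingType) (M : lmodType R) : Prop :=
  forall (N N' : lmodType R) (f : {linear N -> N'}), injective f ->
  forall (T T' : lmodType R) (tau : N -> M -> T) (tau' : N' -> M -> T'),
    is_tensor_product tau -> is_tensor_product tau' ->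
  forall f_M : {linear T -> T'},
    (forall x m, f_M (tau x m) = tau' (f x) m) -> injective f_M.

Definition projective (R : pzRingType) (M : lmodType R) : Prop :=
  forall (N N' : lmodType R) (g : {linear N -> N'}),
    (forall y, exists x, g x = y) ->
  forall h : {linear M -> N'}, exists k : {linear M -> N},
    forall m, g (k m) = h m.

Definition perfect (R : comPzRingType) : Prop :=
  forall M : lmodType R, flat M -> projective M.

Section IdealQuotient.
Variables (A : comPzRingType) (s : seq A).

Definition ideal_gen : {pred A} :=
  fun a => `[< exists c : 'I_(size s) -> A, a = \sum_i c i * s`_i >].

Lemma ideal_gen_zmod_closed : zmod_closed ideal_gen.
Proof.
split; first by apply/asboolP; exists (fun=> 0); rewrite big1// => i _; rewrite mul0r.
move=> _ _ /asboolP[c ->] /asboolP[c' ->]; apply/asboolP.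
exists (fun i => c i - c' i); rewrite -sumrB.
by apply: eq_bigr => i _; rewrite mulrBl.
Qed.

Lemma ideal_genMl a u : u \in ideal_gen -> a * u \in ideal_gen.
Proof.
move=> /asboolP[c ->]; apply/asboolP; exists (fun i => a * c i).
by rewrite mulr_sumr; apply: eq_bigr => i _; rewrite mulrA.
Qed.

HB.instance Definition _ := GRing.isZmodClosed.Build A ideal_gen
  ideal_gen_zmod_closed.

Definition quotient_ring : Type := Quotient.quot ideal_gen.

HB.instance Definition _ : EqQuotient A (Quotient.equiv ideal_gen)
  quotient_ring := EqQuotient.on quotient_ring.
HB.instance Definition _ := GRing.Zmodule.on quotient_ring.

Let one : quotient_ring := \pi_quotient_ring (1 : A).
Let mul (x y : quotient_ring) : quotient_ring :=
  \pi_quotient_ring ((repr x : A) * repr y).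

Lemma eq_quotient_ring (a b : A) :
  (\pi_quotient_ring a == \pi b) = (a - b \in ideal_gen).
Proof. by rewrite piE. Qed.

Let pi_mul (a b : A) : \pi_quotient_ring (a * b) = mul (\pi a) (\pi b).
Proof.
apply/eqP; rewrite eq_quotient_ring.
set a' := repr _; set b' := repr _.
have -> : a * b - a' * b' = a * (b - b') + b' * (a - a').
  by rewrite !mulrBr (mulrC b' a) (mulrC b' a') addrA subrK.
by rewrite rpredD // ideal_genMl // -eq_quotient_ring reprK.
Qed.

Let mulA : associative mul.
Proof.
by move=> x y z; rewrite -[x]reprK -[y]reprK -[z]reprK -!pi_mul mulrA.
Qed.

Let mulC : commutative mul.
Proof. by move=> x y; rewrite -[x]reprK -[y]reprK -!pi_mul mulrC. Qed.

Let mul1 : left_id one mul.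
Proof. by move=> x; rewrite -[x]reprK -pi_mul mul1r. Qed.

Let mulDl : left_distributive mul +%R.
Proof.
move=> x y z; rewrite -[x]reprK -[y]reprK -[z]reprK.
have piD u v : \pi_quotient_ring (u + v) = \pi u + \pi v :> quotient_ring.
  exact: (@pi_addr _ _ _ _ _ (Quotient.quot ideal_gen)).
by rewrite -piD -!pi_mul -piD mulrDl.
Qed.

HB.instance Definition _ := GRing.Zmodule_isComPzRing.Build quotient_ring
  mulA mulC mul1 mulDl.

Definition quotient_map (a : A) : quotient_ring := \pi_quotient_ring a.

Lemma quotient_mapD : {morph quotient_map : a b / a + b}.
Proof. by move=> a b; exact: (@pi_addr _ _ _ _ _ (Quotient.quot ideal_gen)). Qed.

Lemma quotient_map1 : quotient_map 1 = 1.
Proof. by []. Qed.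

Lemma quotient_mapM : {morph quotient_map : a b / a * b}.
Proof. exact: pi_mul. Qed.

Lemma eq_quotient_map a b :
  (quotient_map a == quotient_map b) = (a - b \in ideal_gen).
Proof. exact: eq_quotient_ring. Qed.

Lemma quotient_map_surj x : exists a, quotient_map a = x.
Proof. by exists (repr x); rewrite /quotient_map reprK. Qed.

End IdealQuotient.

Section TotalQuotient.
Variable A : comPzRingType.

(* GRing.lreg s says that multiplication by s is injective: s is a
   non-zero-divisor. *)
Definition prefraction : Type :=
  {f : A * A | `[< GRing.lreg f.2 >]}.

Implicit Types f g h : prefraction.

HB.instance Definition _ := Choice.on prefraction.

Let num f : A := (val f).1.
Let den f : A := (val f).2.

Let denP f : GRing.lreg (den f).
Proof. exact/asboolP/(valP f). Qed.

Definition eq_prefraction f g := num f * den g == num g * den f.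

Let eq_prefraction_equiv : equiv_class_of eq_prefraction.
Proof.
split=> [f|f g|g f h]; rewrite /eq_prefraction; [exact: eqxx|exact: eq_sym|].
move=> /eqP fg /eqP gh; apply/eqP/(denP (f := g)).
by rewrite [LHS]mulrCA mulrA fg mulrAC gh [RHS]mulrCA mulrA.
Qed.

Canonical eq_prefraction_rel := EquivRelPack eq_prefraction_equiv.
Canonical eq_prefraction_enc := defaultEncModRel eq_prefraction.

Definition total_quotient : Type := {eq_quot eq_prefraction}.

HB.instance Definition _ : EqQuotient prefraction eq_prefraction
  total_quotient := EqQuotient.on total_quotient.
HB.instance Definition _ := Choice.on total_quotient.

Let mkP (a s : A) : GRing.lreg s -> `[< GRing.lreg (a, s).2 >].
Proof. by move=> h; apply/asboolP. Qed.

Definition fraction (a s : A) (hs : GRing.lreg s) : total_quotient :=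
  \pi_total_quotient (Sub (a, s) (mkP a hs) : prefraction).

Lemma eq_fraction (a b s t : A) (hs : GRing.lreg s) (ht : GRing.lreg t) :
  (fraction a hs == fraction b ht) = (a * t == b * s).
Proof. by rewrite /fraction piE /eq_prefraction /num /den !SubK. Qed.

Let fraction_repr (x : total_quotient) :
  fraction (num (repr x)) (denP (f := repr x)) = x.
Proof.
rewrite -[RHS]reprK; apply/eqP.
by rewrite /fraction piE /eq_prefraction /num /den !SubK.
Qed.

Lemma fractionP (x : total_quotient) :
  exists a s (hs : GRing.lreg s), x = fraction a hs.
Proof. by exists (num (repr x)), (den (repr x)), (denP (f := repr x)). Qed.

Let zero : total_quotient := fraction 0 (@GRing.lreg1 A).
Let one : total_quotient := fraction 1 (@GRing.lreg1 A).
Let opp (x : total_quotient) : total_quotient :=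
  fraction (- num (repr x)) (denP (f := repr x)).
Let add (x y : total_quotient) : total_quotient :=
  fraction (num (repr x) * den (repr y) + num (repr y) * den (repr x))
    (GRing.lregM (denP (f := repr x)) (denP (f := repr y))).
Let mul (x y : total_quotient) : total_quotient :=
  fraction (num (repr x) * num (repr y))
    (GRing.lregM (denP (f := repr x)) (denP (f := repr y))).

Let reprE (a s : A) (hs : GRing.lreg s) :
  num (repr (fraction a hs)) * s = a * den (repr (fraction a hs)).
Proof.
apply/eqP; rewrite -(eq_fraction _ _ (denP (f := repr (fraction a hs))) hs).
by rewrite fraction_repr.
Qed.

Let oppE (a s : A) (hs : GRing.lreg s) :
  opp (fraction a hs) = fraction (- a) hs.
Proof.
by apply/eqP; rewrite eq_fraction !mulNr reprE.
Qed.

Let addE (a b s t : A) (hs : GRing.lreg s) (ht : GRing.lreg t) :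
  add (fraction a hs) (fraction b ht) =
  fraction (a * t + b * s) (GRing.lregM hs ht).
Proof.
apply/eqP; rewrite eq_fraction !mulrDl; apply/eqP.
have := reprE a hs; have := reprE b ht.
move: (num _) (den _) (num _) (den _) => n1 d1 n2 d2 E2 E1.
congr (_ + _).
  by rewrite [LHS]mulrACA E1 [RHS]mulrACA (mulrC t d2).
by rewrite (mulrC s t) [LHS]mulrACA E2 (mulrC d1 d2) [RHS]mulrACA (mulrC s d1).
Qed.

Let mulE (a b s t : A) (hs : GRing.lreg s) (ht : GRing.lreg t) :
  mul (fraction a hs) (fraction b ht) =
  fraction (a * b) (GRing.lregM hs ht).
Proof.
apply/eqP; rewrite eq_fraction mulrACA (reprE a hs) (reprE b ht).
by rewrite mulrACA.
Qed.

Let addA : associative add.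
Proof.
move=> x y z; have [a [s [hs ->]]] := fractionP x.
have [b [t [ht ->]]] := fractionP y; have [c [u [hu ->]]] := fractionP z.
rewrite !addE; apply/eqP; rewrite eq_fraction; apply/eqP.
congr (_ * _); last by rewrite mulrA.
by rewrite !mulrDl !mulrA addrA (mulrAC b u s) -(mulrA c t s) (mulrC t s) mulrA.
Qed.

Let addC : commutative add.
Proof.
move=> x y; have [a [s [hs ->]]] := fractionP x.
have [b [t [ht ->]]] := fractionP y.
by rewrite !addE; apply/eqP; rewrite eq_fraction addrC (mulrC t).
Qed.

Let add0 : left_id zero add.
Proof.
move=> x; have [a [s [hs ->]]] := fractionP x.
by rewrite addE; apply/eqP; rewrite eq_fraction mul0r add0r mulr1 mul1r.
Qed.

Let addN : left_inverse zero opp add.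
Proof.
move=> x; have [a [s [hs ->]]] := fractionP x.
by rewrite oppE addE; apply/eqP; rewrite eq_fraction mulNr addNr !mul0r.
Qed.

HB.instance Definition _ := GRing.isZmodule.Build total_quotient
  addA addC add0 addN.

Let mulA : associative mul.
Proof.
move=> x y z; have [a [s [hs ->]]] := fractionP x.
have [b [t [ht ->]]] := fractionP y; have [c [u [hu ->]]] := fractionP z.
by rewrite !mulE; apply/eqP; rewrite eq_fraction !mulrA.
Qed.

Let mulC : commutative mul.
Proof.
move=> x y; have [a [s [hs ->]]] := fractionP x.
have [b [t [ht ->]]] := fractionP y.
by rewrite !mulE; apply/eqP; rewrite eq_fraction (mulrC a) (mulrC t).
Qed.

Let mul1 : left_id one mul.
Proof.
move=> x; have [a [s [hs ->]]] := fractionP x.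
by rewrite mulE; apply/eqP; rewrite eq_fraction !mul1r.
Qed.

Let mulDl : left_distributive mul add.
Proof.
move=> x y z; have [a [s [hs ->]]] := fractionP x.
have [b [t [ht ->]]] := fractionP y; have [c [u [hu ->]]] := fractionP z.
rewrite !(addE, mulE); apply/eqP; rewrite eq_fraction; apply/eqP.
have -> : a * c * (t * u) + b * c * (s * u) = (a * t + b * s) * c * u.
  by rewrite !mulrDl [in LHS]mulrACA [b * c * _]mulrACA !mulrA.
rewrite -[RHS]mulrA; congr (_ * _).
by rewrite mulrACA mulrA mulrC.
Qed.

HB.instance Definition _ := GRing.Zmodule_isComPzRing.Build total_quotient
  mulA mulC mul1 mulDl.

Lemma fraction0 : fraction 0 (@GRing.lreg1 A) = 0.
Proof. by []. Qed.

Lemma fraction1 : fraction 1 (@GRing.lreg1 A) = 1.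
Proof. by []. Qed.

Lemma fractionD (a b s t : A) (hs : GRing.lreg s) (ht : GRing.lreg t) :
  fraction a hs + fraction b ht =
  fraction (a * t + b * s) (GRing.lregM hs ht).
Proof. exact: addE. Qed.

Lemma fractionM (a b s t : A) (hs : GRing.lreg s) (ht : GRing.lreg t) :
  fraction a hs * fraction b ht = fraction (a * b) (GRing.lregM hs ht).
Proof. exact: mulE. Qed.

End TotalQuotient.

Definition subperfect (A : comPzRingType) : Prop := perfect (total_quotient A).

(* The empty sequence is regular by convention, also over the zero ring. *)
Definition regular_sequence (A : comPzRingType) (s : seq A) : Prop :=
  (s <> [::] -> exists a, a \notin ideal_gen s) /\
  forall i, (i < size s)%N -> GRing.lreg (quotient_map (take i s) s`_i).

Definition maximal_regular_sequence (A : comPzRingType) (s : seq A) : Prop :=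
  regular_sequence s /\ forall a, ~ regular_sequence (rcons s a).

Definition regularly_subperfect (A : comPzRingType) : Prop :=
  forall s : seq A, regular_sequence s -> subperfect (quotient_ring s).

(* "Every maximal regular sequence has length n" includes that regular
   sequences extend to maximal ones; without this, a ring all of whose regular
   sequences can be prolonged indefinitely, such as k[X_1, X_2, ...], would be
   n-subperfect for all n. *)
Definition n_subperfect (n : nat) (A : comPzRingType) : Prop :=
  [/\ regularly_subperfect A,
      forall s : seq A, regular_sequence s ->
        exists t, maximal_regular_sequence (s ++ t)
    & forall s : seq A, maximal_regular_sequence s -> size s = n].

Section Veronese.
Variables (R : comNzRingType) (n d : nat).

(* The generated R-subalgebra, as the intersection of the R-subalgebras that
   contain all monomials of degree d. *)
Definition veronese_pred : {pred {mpoly R[n]}} :=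
  fun p => `[< forall T : {pred {mpoly R[n]}}, GRing.subalg_closed T ->
    (forall m : 'X_{1..n}, mdeg m = d -> 'X_[m] \in T) -> p \in T >].

Lemma veronese_subring_closed : subring_closed veronese_pred.
Proof.
split.
- by apply/asboolP => T [T1 _ _] _.
- move=> p q /asboolP hp /asboolP hq; apply/asboolP => T hT hm.
  exact: (GRing.linear_closedB (let: And3 _ h _ := hT in h)) (hp T hT hm) (hq T hT hm).
- move=> p q /asboolP hp /asboolP hq; apply/asboolP => T hT hm.
  by have [_ _ TM] := hT; apply: TM; [exact: hp|exact: hq].
Qed.

Definition veronese : Type := {p : {mpoly R[n]} | p \in veronese_pred}.

HB.instance Definition _ := SubChoice.on veronese.
HB.instance Definition _ := GRing.SubChoice_isSubComPzRing.Build {mpoly R[n]}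
  (fun p => p \in veronese_pred) veronese veronese_subring_closed.

End Veronese.

(* Main.v *)
Require Import Defs.
From HB Require Import structures.
From mathcomp Require Import all_boot all_order all_algebra.
From mathcomp Require Import boolp classical_sets functions mpoly ring perm.

(** Perfectness is a chain condition. By Bass, a commutative ring is perfect
    exactly when it satisfies the descending chain condition on principal ideals
    ([principal_dcc]). If flat modules are projective, the direct limit of
    A -> A -> A -> ..., whose maps are multiplication by a_0, a_1, ..., splits
    off a free module, and comparing coordinates stabilizes the chain of the
    products a_0 ... a_k. The argument works verbatim for matrices
    ([perfect_matrix_dcc]), and that version carries the condition from a ring
    to its finite projective algebras. Conversely, the condition cuts the ring
    into finitely many local pieces with T-nilpotent maximal ideal, over which
    Nakayama's lemma needs no finiteness and every flat module has a basis
    ([dcc_perfect]).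

    Let V be the Veronese subring and P_m the polynomial ring over R in m
    variables, built one variable at a time. Sending the i-th variable to X_i^d
    makes V a finite projective algebra over P_n
    ([veronese_finite_projective]). Suppose that R is perfect. The key point is
    that each element of a regular sequence uses up exactly one variable. Let A
    be finite projective over P_m = P_(m-1)[t] and let a be regular in A. The
    constant term of an integral equation for a yields a multiple of a which is
    the image of a regular polynomial f ([regular_multiple]). A change of
    variables as in Noether normalization makes a multiple of f monic in t
    ([iterated_poly_normalizable]). Division by a monic polynomial is a
    P_(m-1)-linear retraction of multiplication by that polynomial, hence
    multiplication by a also has such a retraction and A/aA is a direct summand
    of A over P_(m-1); it is finitely generated because f kills it
    ([finite_projective_quotient]).

    So V/(s) is finite projective over P_(n-i) for each regular sequence s of
    length i ([regular_sequence_quotient]). If i = n, regular elements of V/(s)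
    divide regular elements of R, which are units, and s is maximal. If i < n,
    the last variable of P_(n-i) is regular but not a unit on V/(s), and s can
    be prolonged. The total quotient ring of V/(s) inherits the chain condition
    from that of P_(n-i) ([finite_projective_dcc]), which in turn has it because
    adjoining a variable preserves the decomposition of R into pieces on which
    each element is nilpotent or regular ([poly_primary_ring]).

    If instead V is n-subperfect, the sequence X_n^d, ..., X_1^d is regular of
    length n for any R ([parameter_sequence]), hence maximal. All regular
    elements of the quotient by it are then units, so this quotient is its own
    total quotient ring and satisfies the chain condition; evaluation at the
    origin maps it onto R, which is therefore perfect ([n_subperfect_dcc]). *)

Set Implicit Arguments.
Unset Strict Implicit.
Unset Printing Implicit Defensive.

Import GRing.Theory.
Import Pdiv.Ring Pdiv.RingMonic.

Local Open Scope ring_scope.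
Local Open Scope quotient_scope.

(** * Quotient modules, submodules and tensor products *)

Definition linear_fun (R : pzRingType) (U V : lmodType R) (f : U -> V)
    (f_linear : linear f) : {linear U -> V} :=
  HB.pack f (GRing.isLinear.Build R U V *:%R f f_linear).

Definition ring_hom (R S : pzRingType) (f : R -> S) (f_zmod : zmod_morphism f)
    (f_monoid : monoid_morphism f) : {rmorphism R -> S} :=
  HB.pack f (GRing.isZmodMorphism.Build R S f f_zmod)
    (GRing.isMonoidMorphism.Build R S f f_monoid).

Section QuotientModule.
Variables (R : pzRingType) (V : lmodType R) (W : V -> Prop).
Hypothesis W0 : W 0.
Hypothesis W_linear : forall a u v, W u -> W v -> W (a *: u + v).

Let S : {pred V} := fun v => `[< W v >].

Let S_zmod_closed : zmod_closed S.
Proof.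
split=> [|u v /asboolP Wu /asboolP Wv]; first exact/asboolP.
by apply/asboolP; rewrite addrC -scaleN1r; exact: W_linear.
Qed.

HB.instance Definition _ := GRing.isZmodClosed.Build V S S_zmod_closed.

Let Q : zmodType := Quotient.quot S.

Let piE (u v : V) : (\pi_(Quotient.quot S) u = \pi v) <-> W (u - v).
Proof. by rewrite (rwP eqP) piE; split=> /asboolP. Qed.

Let piB u v : W (u - v) -> \pi_(Quotient.quot S) u = \pi v.
Proof. by move/piE. Qed.

Let scale (a : R) (x : Q) : Q := \pi_(Quotient.quot S) (a *: (repr x : V)).

Let pi_scale a (u : V) : \pi_(Quotient.quot S) (a *: u) = scale a (\pi_(Quotient.quot S) u).
Proof.
apply: piB; rewrite -scalerBr -[X in W X]addr0; apply: W_linear => //.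
by apply/piE; rewrite reprK.
Qed.

Let piD (u v : V) : \pi_(Quotient.quot S) (u + v) =
  \pi_(Quotient.quot S) u + \pi_(Quotient.quot S) v :> Q.
Proof. exact: (@pi_addr _ _ _ _ _ (Quotient.quot S)). Qed.

Let scaleA a b x : scale a (scale b x) = scale (a * b) x.
Proof. by rewrite -[x]reprK -(pi_scale b) -(pi_scale a) -(pi_scale (a * b)) scalerA. Qed.
Let scale1 : left_id 1 scale.
Proof. by move=> x; rewrite -[x]reprK -!pi_scale scale1r. Qed.
Let scaleDr : right_distributive scale +%R.
Proof.
move=> a x y; rewrite -[x]reprK -[y]reprK -piD -(pi_scale a (_ + _)).
by rewrite -(pi_scale a (repr x)) -(pi_scale a (repr y)) -piD scalerDr.
Qed.
Let scaleDl x : {morph scale^~ x : a b / a + b}.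
Proof.
move=> a b; rewrite -[x]reprK -(pi_scale (a + b)) -(pi_scale a (repr x)).
by rewrite -(pi_scale b (repr x)) -piD scalerDl.
Qed.

(** Quotients are produced as existence statements, so that each use can carry
    its own propositional submodule [W] without registering it as a structure. *)
Lemma quotient_module : exists (M : lmodType R) (p : {linear V -> M}),
  (forall y, exists x, p x = y) /\ (forall x, p x = 0 <-> W x).
Proof.
pose mx := GRing.Zmodule_isLmodule.Build R Q scaleA scale1 scaleDr scaleDl.
pose M : lmodType R := HB.pack Q mx.
pose p : V -> M := fun u => \pi_(Quotient.quot S) u.
have p_lin : linear p by move=> a u v; rewrite /p piD pi_scale.
exists M, (linear_fun p_lin); split=> [y|x].
  by exists (repr y); rewrite -[RHS]reprK.
by rewrite -(linear0 (linear_fun p_lin)) piE subr0.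
Qed.
End QuotientModule.

Lemma quotient_factor (R : pzRingType) (V M P : lmodType R)
    (p : {linear V -> M}) (g : {linear V -> P}) :
    (forall y, exists x, p x = y) -> (forall x, p x = 0 -> g x = 0) ->
  exists h : {linear M -> P}, forall x, h (p x) = g x.
Proof.
move=> /choice[lift liftK] pg.
have g_p x y : p x = p y -> g x = g y.
  move=> xy; apply/eqP; rewrite -subr_eq0 -linearB; apply/eqP/pg.
  by rewrite linearB xy subrr.
have h_lin : linear (g \o lift).
  by move=> a x y /=; rewrite -linearP; apply: g_p; rewrite linearP !liftK.
by exists (linear_fun h_lin) => x; apply: g_p; rewrite liftK.
Qed.

Section Submodule.
Variables (R : pzRingType) (V : lmodType R) (W : V -> Prop).
Hypothesis W0 : W 0.
Hypothesis W_linear : forall a u v, W u -> W v -> W (a *: u + v).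

Let S : {pred V} := fun v => `[< W v >].

Let S_submod_closed : GRing.submod_closed S.
Proof.
split=> [|a u v /asboolP Wu /asboolP Wv]; first exact/asboolP.
by apply/asboolP; exact: W_linear.
Qed.

HB.instance Definition _ := GRing.isSubmodClosed.Build R V S S_submod_closed.

Let L : Type := {v : V | v \in S}.
HB.instance Definition _ := SubChoice.on L.
HB.instance Definition _ := [SubChoice_isSubLmodule of L by <:].

Lemma submodule : exists (M : lmodType R) (i : {linear M -> V}),
  injective i /\ (forall v, W v <-> exists x, i x = v).
Proof.
exists L, (val : {linear L -> V}); split; first exact: val_inj.
move=> v; split=> [Wv|[x <-]]; last exact/asboolP/(valP x).
have Sv : v \in S by exact/asboolP.
by exists (exist _ v Sv).
Qed.
End Submodule.

Section TensorProducts.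
Variables (R : pzRingType) (M N T : lmodType R) (tau : M -> N -> T).
Hypothesis tauP : is_tensor_product tau.

Lemma tensor_bilinear : bilinear_map tau. Proof. by case: tauP. Qed.

Lemma tensorDl x y n : tau (x + y) n = tau x n + tau y n.
Proof. exact: (linearD (linear_fun (tensor_bilinear.1 n))). Qed.

Lemma tensor0l n : tau 0 n = 0.
Proof. exact: (linear0 (linear_fun (tensor_bilinear.1 n))). Qed.

Lemma tensorZl a x n : tau (a *: x) n = a *: tau x n.
Proof. exact: (linearZZ (linear_fun (tensor_bilinear.1 n))). Qed.

Lemma tensorZr a m x : tau m (a *: x) = a *: tau m x.
Proof. exact: (linearZZ (linear_fun (tensor_bilinear.2 m))). Qed.

Lemma tensor_suml I (s : seq I) (P : pred I) (F : I -> M) n :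
  tau (\sum_(i <- s | P i) F i) n = \sum_(i <- s | P i) tau (F i) n.
Proof. exact: (linear_sum (linear_fun (tensor_bilinear.1 n))). Qed.

Lemma tensor_sumr I (s : seq I) (P : pred I) (F : I -> N) m :
  tau m (\sum_(i <- s | P i) F i) = \sum_(i <- s | P i) tau m (F i).
Proof. exact: (linear_sum (linear_fun (tensor_bilinear.2 m))). Qed.

(** The projection of [T] onto its quotient by [W] and the zero map agree on pure
    tensors, so they are equal by the uniqueness half of the universal property. *)
Lemma tensor_span (W : T -> Prop) : W 0 ->
    (forall a u v, W u -> W v -> W (a *: u + v)) ->
    (forall m n, W (tau m n)) ->
  forall z, W z.
Proof.
move=> W0 W_lin W_tau z; have [U [p [_ pE]]] := quotient_module W0 W_lin.
have zero_bil : bilinear_map (fun (_ : M) (_ : N) => 0 : U).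
  by split=> [n|m] a x y; rewrite scaler0 addr0.
have [h [_ h_uniq]] := tauP.2 U _ zero_bil.
have p_eq : p =1 h by apply: h_uniq => m n; exact/pE.
have zero_eq : (\0 : {linear T -> U}) =1 h by apply: h_uniq.
by apply/pE; rewrite p_eq -zero_eq.
Qed.
End TensorProducts.

(** * Flat direct limits: perfect rings satisfy the descending chain condition *)

Section BassModule.
Variables (Q : comPzRingType) (r : nat) (A : nat -> 'M[Q]_r).

Let steps j k : 'M[Q]_r := \prod_(j <= i < k) A i.

Let steps_cat j k l : (j <= k)%N -> (k <= l)%N ->
  steps j l = steps j k *m steps k l.
Proof. by move=> jk kl; rewrite /steps (big_cat_nat jk kl). Qed.

Let finite_support (h : nat -> 'rV[Q]_r) : Prop :=
  exists K, forall k, (K <= k)%N -> h k = 0.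

Let finite_support0 : finite_support 0.
Proof. by exists 0%N. Qed.

Let finite_support_linear a u v : finite_support u -> finite_support v ->
  finite_support (a *: u + v).
Proof.
move=> [K uK] [L vL]; exists (maxn K L) => k; rewrite geq_max => /andP[Kk Lk].
by rewrite !fctE uK// vL// scaler0 addr0.
Qed.

Section FlatLimit.
Variables (F M : lmodType Q) (i : {linear F -> (nat -> 'rV[Q]_r)}) (p : {linear F -> M}).
Hypothesis i_inj : injective i.
Hypothesis iP : forall h, finite_support h <-> exists x, i x = h.

(** The modules in the directed system are all equal to the space of row vectors;
    [stage K x] is the sum of the entries of the sequence [x], each transported
    from its own index to the index [K]. *)
Definition stage K (x : F) : 'rV[Q]_r := \sum_(j < K) i x j *m steps j K.

Hypothesis pE : forall x, p x = 0 <-> exists K0, forall K, (K0 <= K)%N -> stage K x = 0.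
Hypothesis p_surj : forall y, exists x, p x = y.

Lemma stage_linear K : linear (stage K).
Proof.
move=> a x y; rewrite /stage scaler_sumr -big_split /=; apply: eq_bigr => j _.
by rewrite linearP !fctE mulmxDl scalemxAl.
Qed.

Lemma stageB K x y : stage K (x - y) = stage K x - stage K y.
Proof. exact: (linearB (linear_fun (stage_linear K))). Qed.

Lemma stage_shift K L x : (forall k, (K <= k)%N -> i x k = 0) -> (K <= L)%N ->
  stage L x = stage K x *m steps K L.
Proof.
move=> xK KL; rewrite /stage -(big_mkord predT (fun j => i x j *m steps j L)).
rewrite -(big_mkord predT (fun j => i x j *m steps j K)).
rewrite (big_cat_nat (leq0n K) KL) /= [X in _ + X]big_nat_cond.
rewrite [X in _ + X]big1 ?addr0; last first.
  by move=> j /andP[/andP[/xK-> _] _]; rewrite mul0mx.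
rewrite mulmx_suml big_nat_cond [RHS]big_nat_cond.
apply: eq_bigr => j /andP[/andP[_ jK] _].
by rewrite (steps_cat (ltnW jK) KL) mulmxA.
Qed.

Lemma finite_support_at k v : finite_support (fun j => if j == k then v else 0).
Proof. by exists k.+1 => j kj; rewrite gtn_eqF. Qed.

Definition at_stage k v : F := sval (cid ((iP _).1 (finite_support_at k v))).

Lemma at_stageE k v : i (at_stage k v) = fun j => if j == k then v else 0.
Proof. by rewrite /at_stage; case: cid. Qed.

Lemma stage_at k v K : (k < K)%N -> stage K (at_stage k v) = v *m steps k K.
Proof.
move=> kK; rewrite /stage at_stageE (bigD1 (Ordinal kK)) //= eqxx big1 ?addr0//.
move=> j /negPf jk; rewrite -val_eqE /= in jk.
by rewrite jk mul0mx.
Qed.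

Definition from_stage k v : M := p (at_stage k v).

Lemma from_stage_linear k : linear (from_stage k).
Proof.
move=> a u v; rewrite /from_stage -linearP; congr (p _); apply: i_inj.
rewrite linearP !at_stageE; apply/funext => j; rewrite !fctE.
by case: eqP; rewrite ?scaler0 ?addr0.
Qed.

Lemma from_stage_shift k K v : (k <= K)%N -> from_stage k v = from_stage K (v *m steps k K).
Proof.
move=> kK; apply/eqP; rewrite -subr_eq0; apply/eqP.
rewrite -linearB; apply/pE; exists K.+1 => L KL.
rewrite stageB !stage_at ?(leq_ltn_trans kK)//.
by rewrite -mulmxA -(steps_cat kK (ltnW KL)) subrr.
Qed.

(** Each element of the limit comes from a finite stage, because the sequences
    have finite support. *)
Lemma limit_from_stage x K : (forall k, (K <= k)%N -> i x k = 0) -> p x = from_stage K (stage K x).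
Proof.
move=> xK; apply/eqP; rewrite -subr_eq0 -linearB; apply/eqP/pE.
exists K.+1 => L KL; rewrite stageB.
by rewrite stage_at// (stage_shift xK (ltnW KL)) subrr.
Qed.

Lemma from_stage_delta k v : from_stage k v = \sum_q v 0 q *: from_stage k (delta_mx 0 q).
Proof.
pose from_stagek := linear_fun (from_stage_linear k).
rewrite -[LHS]/(from_stagek v) {1}[v]row_sum_delta linear_sum.
by apply: eq_bigr => q _; rewrite linearZ.
Qed.

Lemma delta_shift k K q : (k <= K)%N ->
  from_stage k (delta_mx 0 q) = \sum_s steps k K q s *: from_stage K (delta_mx 0 s).
Proof.
move=> kK; rewrite (from_stage_shift _ kK) from_stage_delta; apply: eq_bigr => s _.
by rewrite -rowE mxE.
Qed.

(** A direct limit of free modules is flat. A tensor with the limit is a tensor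
    [elt k n] with one of the free stages, that is, a family of [r] elements;
    when its image under an injection vanishes, the family of images vanishes at
    a later stage, and by injectivity so does the family itself. That vanishing
    in the target is detected by a bilinear map into sequences of families
    modulo the eventually zero ones. *)
Lemma flat_limit : flat M.
Proof.
move=> N N' f f_inj T T' tau tau' tauP tau'P g g_tau.
(* Every tensor lives at a finite stage. *)
pose elt k (n : 'I_r -> N) := \sum_q tau (n q) (from_stage k (delta_mx 0 q)).
have shift k K n : (k <= K)%N ->
    elt k n = elt K (fun s => \sum_q steps k K q s *: n q).
  move=> kK; rewrite /elt; under eq_bigr => q _ do rewrite (delta_shift q kK).
  under eq_bigr => q _ do rewrite (tensor_sumr tauP).
  rewrite exchange_big; apply: eq_bigr => s _; rewrite (tensor_suml tauP).
  by apply: eq_bigr => q _; rewrite (tensorZl tauP) (tensorZr tauP).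
have elt_lin a k (m n : 'I_r -> N) :
    a *: elt k m + elt k n = elt k (fun q => a *: m q + n q).
  rewrite /elt scaler_sumr -big_split; apply: eq_bigr => q _ /=.
  by rewrite (tensorDl tauP) (tensorZl tauP).
have elt_all z : exists k n, z = elt k n.
  move: z; apply: (tensor_span tauP).
  - by exists 0%N, (fun=> 0); rewrite /elt big1// => q _; rewrite (tensor0l tauP).
  - move=> a _ _ [k [m ->]] [l [n ->]].
    rewrite (shift _ _ _ (leq_maxl k l)) (shift _ _ _ (leq_maxr k l)) elt_lin.
    by do 2!eexists.
  - move=> n y; have [x <-] := p_surj y.
    have [K xK] : finite_support (i x) by apply/iP; exists x.
    exists K, (fun q => stage K x 0 q *: n); rewrite (limit_from_stage xK) from_stage_delta.
    rewrite (tensor_sumr tauP); apply: eq_bigr => q _.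
    by rewrite (tensorZr tauP) (tensorZl tauP).
suff g_ker z : g z = 0 -> z = 0.
  by move=> x y /eqP; rewrite -subr_eq0 -linearB => /eqP/g_ker/eqP; rewrite subr_eq0 => /eqP.
have [k [n {z}->]] := elt_all z; rewrite linear_sum => g0.
(* Coordinates of the stages of a sequence, up to finitely many stages. *)
pose W (h : nat -> 'I_r -> N') := exists K0, forall K, (K0 <= K)%N -> h K = 0.
have W0 : W 0 by exists 0%N.
have W_lin a u v : W u -> W v -> W (a *: u + v).
  move=> [K uK] [L vL]; exists (maxn K L) => l; rewrite geq_max => /andP[Kl Ll].
  by rewrite -[LHS]/(a *: u l + v l) uK// vL// scaler0 addr0.
have [P [pi [_ piE]]] := quotient_module W0 W_lin.
have [lift liftK] := choice p_surj.
pose coords (x : F) (n' : N') : nat -> 'I_r -> N' := fun K q => stage K x 0 q *: n'.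
have coords_p x y n' : p x = p y -> pi (coords x n') = pi (coords y n').
  move/eqP; rewrite -subr_eq0 -linearB => /eqP/pE[K0 xy].
  apply/eqP; rewrite -subr_eq0 -linearB; apply/eqP/piE; exists K0 => K /xy.
  rewrite stageB => /matrixP xyK.
  apply/funext => q; rewrite /coords !fctE -scalerBl.
  by have := xyK 0 q; rewrite !mxE => ->; rewrite scale0r.
pose b (n' : N') (y : M) := pi (coords (lift y) n').
have b_bil : bilinear_map b.
  split=> [y|n'] a x z.
    rewrite /b -linearP; congr (pi _); apply/funext => K; apply/funext => q.
    set c := stage K (lift y) 0 q.
    rewrite -[LHS]/(c *: (a *: x + z)) -[RHS]/(a *: (c *: x) + c *: z).
    by rewrite scalerDr !scalerA mulrC.
  rewrite /b -linearP (coords_p _ (a *: lift x + lift z)); last first.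
    by rewrite linearP !liftK.
  congr (pi _); apply/funext => K; apply/funext => q.
  rewrite -[RHS]/(a *: (stage K (lift x) 0 q *: n') + stage K (lift z) 0 q *: n').
  by rewrite /coords stage_linear !mxE scalerDl scalerA.
have [h [hE _]] := tau'P.2 P b b_bil.
have : pi (\sum_q coords (at_stage k (delta_mx 0 q)) (f (n q))) = 0.
  transitivity (h 0); last by rewrite linear0.
  rewrite -g0 !linear_sum; apply: eq_bigr => q _; rewrite g_tau hE.
  by apply: coords_p; rewrite liftK.
move=> /piE[K0 K0P]; set K := maxn K0 k.+1.
have kK : (k < K)%N by rewrite leq_max leqnn orbT.
rewrite (shift _ _ _ (ltnW kK)) /elt big1// => s _.
suff -> : \sum_q steps k K q s *: n q = 0 by rewrite (tensor0l tauP).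
apply: f_inj; rewrite linear0 linear_sum.
have /(congr1 (@^~ s)) := K0P K (leq_maxl _ _).
rewrite !fct_sumE -[X in _ = X -> _]/(0 : N') => coords0.
rewrite -[RHS]coords0.
by apply: eq_bigr => q _; rewrite /coords stage_at// -rowE !mxE linearZ.
Qed.

End FlatLimit.

(** Let [s] be a section of the projection of the free module [F] onto the limit
    [M]. As functions of [v], the entries of the sequence [s (from_stage 0 v)]
    factor through [\prod_(0 <= i < k) A i] for each [k], since [from_stage 0 v] equals
    [from_stage k] of the transported vector. On the other hand, projecting the
    sequence back to [M] recovers [v] at some stage [N] at which
    [\prod_(0 <= i < N) A i] becomes a combination of those entries. The factor
    [X] stands on the right because vectors are rows. *)
Theorem perfect_matrix_dcc : perfect Q ->
  exists N, forall k, exists X : 'M[Q]_r,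
    \prod_(0 <= i < N) A i = (\prod_(0 <= i < k) A i) *m X.
Proof.
move=> Qperf; have [F [i [i_inj iP]]] := submodule finite_support0 finite_support_linear.
pose W (x : F) := exists K0, forall K, (K0 <= K)%N -> stage i K x = 0.
have W0 : W 0.
  by exists 0%N => K _; exact: (linear0 (linear_fun (stage_linear i K))).
have W_lin a u v : W u -> W v -> W (a *: u + v).
  move=> [K uK] [L vL]; exists (maxn K L) => l; rewrite geq_max => /andP[Kl Ll].
  rewrite stage_linear uK// vL//.
  by rewrite scaler0 addr0.
have [M [p [p_surj pE]]] := quotient_module W0 W_lin.
have M_flat : flat M := flat_limit i_inj iP pE p_surj.
have [s sK] := Qperf M M_flat F M p p_surj (@idfun M : {linear M -> M}).
(* The [j]-th entries of the lifted basis vectors of stage [k], as rows of [C k j]. *)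
pose c k q j : 'rV[Q]_r := i (s (from_stage p iP k (delta_mx 0 q))) j.
pose C k j : 'M[Q]_r := \matrix_(q, t) c k q j 0 t.
have C0 k j : C 0%N j = steps 0 k *m C k j.
  apply/matrixP => q t; rewrite !mxE /c (delta_shift i_inj iP pE q (leq0n k)).
  rewrite !linear_sum fct_sumE summxE; apply: eq_bigr => u _.
  by rewrite !linearZ -[LHS]/((steps 0 k q u *: c k u j) 0 t) !mxE.
have /choice[L LP] q : exists L, forall l, (L <= l)%N ->
    stage i l (s (from_stage p iP 0 (delta_mx 0 q))) = delta_mx 0 q *m steps 0 l.
  have : p (s (from_stage p iP 0 (delta_mx 0 q)) - at_stage iP 0 (delta_mx 0 q)) = 0.
    by rewrite linearB sK subrr.
  move=> /pE[L LP]; exists (maxn L 1) => l; rewrite geq_max => /andP[/LP + l0].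
  move/eqP; rewrite stageB subr_eq0 => /eqP->.
  exact: stage_at.
pose N := \max_q L q.
exists N => k; exists (\sum_(j < N) C k j *m steps j N).
rewrite mulmx_sumr; apply/row_matrixP => q; rewrite rowE -LP ?leq_bigmax//.
rewrite /stage linear_sum; apply: eq_bigr => j _ /=.
rewrite mulmxA -C0 row_mul; congr (_ *m _).
by apply/rowP => t; rewrite !mxE.
Qed.

End BassModule.

(** The principal ideals generated by the successive products of a sequence are
    the general descending chain of principal ideals; stabilization is stated
    for the whole tail of the chain at once. *)
Definition principal_dcc (A : comPzRingType) : Prop :=
  forall a : nat -> A, exists N, forall k, exists c,
    \prod_(0 <= i < N) a i = c * \prod_(0 <= i < k) a i.

Theorem perfect_dcc (A : comPzRingType) : perfect A -> principal_dcc A.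
Proof.
move=> Aperf a.
have [N NP] := perfect_matrix_dcc (fun i => (a i)%:M : 'M_1) Aperf.
exists N => k; have [X] := NP k; rewrite -!rmorph_prod mul_scalar_mx => /matrixP.
by move=> /(_ 0 0); rewrite !mxE mulr1n mulrC => ->; exists (X 0 0).
Qed.

(** * Linear relations in flat modules *)

Section EquationalCriterion.
Variables (A : comPzRingType) (M : lmodType A) (I : finType).
Variables (a : I -> A) (x : I -> M).

Let V : lmodType A := I -> A^o.
Let VM : lmodType A := I -> M.
Let K (v : V) := \sum_i a i * v i = 0.
Let KM (z : VM) := exists (J : finType) (c : J -> V) (y : J -> M),
  (forall j, K (c j)) /\ z = fun i => \sum_j c j i *: y j.

(** The equational criterion for flatness. The row [a] factors through an
    injection of [N], the quotient of the free module by the relations [K], into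
    [A]. The tensor product of [N] with [M] is the quotient of the families of
    elements of [M] by those of the form required of [x] in the conclusion, and
    tensoring the injection sends the class of [x] to [\sum_i a i *: x i]. *)
Lemma flat_relation : flat M -> \sum_i a i *: x i = 0 ->
  exists (J : finType) (c : J -> I -> A) (y : J -> M),
    (forall j, \sum_i a i * c j i = 0) /\ forall i, x i = \sum_j c j i *: y j.
Proof.
move=> Mflat ax0.
have K0 : K 0 by rewrite /K big1// => i _; rewrite mulr0.
have K_lin b u v : K u -> K v -> K (b *: u + v).
  rewrite /K => u0 v0; transitivity (b * (\sum_i a i * u i) + \sum_i a i * v i).
    rewrite mulr_sumr -big_split; apply: eq_bigr => i _ /=.
    by rewrite -[(_ + _) i]/(b * u i + v i) mulrDr mulrCA.
  by rewrite u0 v0 mulr0 addr0.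
have KM0 : KM 0.
  exists void, (fun=> 0), (fun=> 0); split=> [[]|].
  by apply/funext => i; rewrite big1//; case.
have KM_lin b u v : KM u -> KM v -> KM (b *: u + v).
  move=> [J [c [y [cK ->]]]] [J' [c' [y' [cK' ->]]]].
  exists (J + J')%type, (fun j => match j with inl j => b *: c j | inr j => c' j end).
  exists (fun j => match j with inl j => y j | inr j => y' j end); split.
    move=> [j|j] //; rewrite -[_ *: _]addr0; exact: K_lin.
  apply/funext => i; rewrite big_sumType /=; congr (_ + _).
  rewrite -[LHS]/(b *: (\sum_j c j i *: y j)) scaler_sumr.
  by apply: eq_bigr => j _; rewrite scalerA.
have [N [p [p_surj pE]]] := quotient_module K0 K_lin.
have [T [q [q_surj qE]]] := quotient_module KM0 KM_lin.
have [lift liftK] := choice p_surj.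
have dot_lin (P : lmodType A) (z : I -> P) : linear (fun v : V => \sum_i v i *: z i).
  move=> b u v; rewrite scaler_sumr -big_split; apply: eq_bigr => i _ /=.
  by rewrite -[(_ + _) i]/(b * u i + v i) scalerDl scalerA.
have [f fE] : exists f : {linear N -> A^o}, forall v, f (p v) = \sum_i a i * v i.
  have [f fE] : exists f : {linear N -> A^o},
      forall v, f (p v) = linear_fun (dot_lin A^o a) v.
    apply: quotient_factor => // v /pE Kv; rewrite -[RHS]Kv.
    by apply: eq_bigr => i _; rewrite mulrC.
  by exists f => v; rewrite fE; apply: eq_bigr => i _; rewrite mulrC.
have f_inj : injective f.
  move=> u v; rewrite -[u]liftK -[v]liftK => uv; apply/eqP.
  rewrite -subr_eq0 -linearB; apply/eqP/pE; rewrite /K.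
  by rewrite -fE !linearB /= uv subrr.
(* The tensor product of N with M is M^I modulo the combinations of M with
   coefficients in K. *)
pose scal (v : V) (m : M) : VM := fun i => v i *: m.
have scal_p u v m : p u = p v -> q (scal u m) = q (scal v m).
  move/eqP; rewrite -subr_eq0 -linearB => /eqP/pE uv.
  apply/eqP; rewrite -subr_eq0 -linearB; apply/eqP/qE.
  exists unit, (fun=> u - v), (fun=> m); split=> //.
  apply/funext => i; rewrite big_const card_unit /= addr0.
  by rewrite -[LHS]/(u i *: m - v i *: m) -scalerBl.
pose tau (n : N) (m : M) := q (scal (lift n) m).
have tauE v m : tau (p v) m = q (scal v m) by apply: scal_p; rewrite liftK.
have tau_bil : bilinear_map tau.
  split=> [m|n] b u v; last first.
    rewrite /tau -linearP; congr (q _); apply/funext => i.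
    rewrite -[LHS]/(lift n i *: (b *: u + v)).
    rewrite -[RHS]/(b *: (lift n i *: u) + lift n i *: v).
    by rewrite scalerDr !scalerA mulrC.
  rewrite -[u]liftK -[v]liftK -linearP !tauE -linearP; congr (q _).
  apply/funext => i; rewrite -[LHS]/((b * lift u i + lift v i) *: m).
  by rewrite -[RHS]/(b *: (lift u i *: m) + lift v i *: m) scalerDl scalerA.
pose delta (i : I) : V := fun j => (j == i)%:R.
have sum_delta (P : lmodType A) i (y : I -> P) : \sum_j delta i j *: y j = y i.
  rewrite (bigD1 i) //= /delta eqxx scale1r big1 ?addr0// => j /negPf->.
  by rewrite scale0r.
have sum_tau z : q z = \sum_i tau (p (delta i)) (z i).
  under eq_bigr => i _ do rewrite tauE.
  rewrite -linear_sum; congr (q _); apply/funext => i; rewrite fct_sumE.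
  rewrite (bigD1 i)//= /scal /delta eqxx scale1r big1 ?addr0// => j /negPf ji.
  by rewrite eq_sym ji scale0r.
have V_delta (v : V) : v = \sum_i v i *: delta i.
  apply/funext => j; rewrite fct_sumE -[LHS](sum_delta A^o j v).
  apply: eq_bigr => i _; rewrite -[RHS]/(v i * delta i j).
  by rewrite [RHS]mulrC /delta eq_sym.
have tauP : is_tensor_product tau.
  split=> // P b b_bil.
  have g_lin : linear (fun z : VM => \sum_i b (p (delta i)) (z i)).
    move=> k u v; rewrite scaler_sumr -big_split; apply: eq_bigr => i _ /=.
    exact: b_bil.2.
  have bsum n s (F : s -> M) (J : seq s) : b n (\sum_(j <- J) F j) = \sum_(j <- J) b n (F j).
    exact: (linear_sum (linear_fun (b_bil.2 n))).
  have bsuml m s (F : s -> N) (J : seq s) : b (\sum_(j <- J) F j) m = \sum_(j <- J) b (F j) m.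
    exact: (linear_sum (linear_fun (b_bil.1 m))).
  have bZr n k m : b n (k *: m) = k *: b n m.
    exact: (linearZZ (linear_fun (b_bil.2 n))).
  have bZl n k m : b (k *: n) m = k *: b n m.
    exact: (linearZZ (linear_fun (b_bil.1 m))).
  have b0 m : b 0 m = 0 by exact: (linear0 (linear_fun (b_bil.1 m))).
  have b_delta v m : \sum_i b (p (delta i)) (v i *: m) = b (p v) m.
    rewrite [in RHS](V_delta v) linear_sum bsuml; apply: eq_bigr => i _.
    by rewrite linearZ /= bZr bZl.
  have [h hE] : exists h : {linear T -> P}, forall z, h (q z) = linear_fun g_lin z.
    apply: quotient_factor => // _ /qE[J [c [y [cK ->]]]].
    rewrite -[LHS]/(\sum_i b (p (delta i)) (\sum_j c j i *: y j)).
    under eq_bigr => i _ do rewrite bsum.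
    rewrite exchange_big big1 //= => j _; rewrite b_delta.
    by rewrite (_ : p (c j) = 0) ?b0//; apply/pE.
  exists h; split=> [n m|h' h'E].
    by rewrite -[n]liftK tauE hE -b_delta.
  move=> t; have [z <-] := q_surj t; rewrite hE sum_tau linear_sum.
  by apply: eq_bigr => i _; rewrite h'E.
have tau'P : is_tensor_product (fun (r : A^o) (m : M) => r *: m).
  split=> [|P b b_bil].
    split=> [m|r] k u v; first by rewrite scalerDl -scalerA.
    by rewrite scalerDr !scalerA mulrC.
  have bZl n k m : b (k *: n) m = k *: b n m.
    exact: (linearZZ (linear_fun (b_bil.1 m))).
  exists (linear_fun (b_bil.2 1)); split=> [r m|h' h'E m].
    by rewrite linearZ /= -bZl; congr (b _ m); exact: mulr1.
  by rewrite -[m in LHS]scale1r h'E.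
have fM_lin : linear (fun z : VM => \sum_i a i *: z i).
  move=> k u v; rewrite scaler_sumr -big_split; apply: eq_bigr => i _ /=.
  by rewrite -[(_ + _) i]/(k *: u i + v i) scalerDr !scalerA mulrC.
have [fM fME] : exists h : {linear T -> M}, forall z, h (q z) = linear_fun fM_lin z.
  apply: quotient_factor => // _ /qE[J [c [y [cK ->]]]].
  rewrite -[LHS]/(\sum_i a i *: (\sum_j c j i *: y j)).
  under eq_bigr => i _ do rewrite scaler_sumr.
  rewrite exchange_big big1 //= => j _; under eq_bigr => i _ do rewrite scalerA.
  by rewrite -scaler_suml cK scale0r.
have fM_tau n m : fM (tau n m) = f n *: m.
  rewrite -[n]liftK tauE fME fE scaler_suml.
  by apply: eq_bigr => i _; rewrite -scalerA.
have fM_inj := Mflat _ _ f f_inj _ _ _ _ tauP tau'P fM fM_tau.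
have /qE[J [c [y [cK xE]]]] : q (x : VM) = 0.
  by apply: fM_inj; rewrite linear0 fME.
by exists J, c, y; split=> // i; rewrite {1}xE.
Qed.

End EquationalCriterion.

(** * Local decomposition of a ring with the descending chain condition *)

Section OnIdempotent.
Variable A : comPzRingType.
Implicit Types e f g h : A.

(** The predicates on [e] describe the behaviour of an element on the factor [eA]
    of the ring cut out by an idempotent [e], without leaving [A]. *)
Definition nil_on e f : Prop := exists k, f ^+ k * e = 0.
Definition unit_on e f : Prop := exists c, c * f * e = e.
Definition regular_on e f : Prop := forall h, f * h * e = 0 -> h * e = 0.
(** T-nilpotence of the nilradical of [eA], in the form in which it is used: a
    sequence with infinitely many nilpotent members has a vanishing product. *)
Definition t_nilpotent_on e : Prop := forall f : nat -> A,
  (forall N, exists j, (N <= j)%N /\ nil_on e (f j)) ->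
  exists N, (\prod_(0 <= i < N) f i) * e = 0.

Lemma nil_on0 e : nil_on e 0.
Proof. by exists 1%N; rewrite expr1 mul0r. Qed.

Lemma nil_onM e f g : nil_on e g -> nil_on e (f * g).
Proof. by move=> [k gk]; exists k; rewrite exprMn -mulrA gk mulr0. Qed.

Lemma nil_onD e f g : nil_on e f -> nil_on e g -> nil_on e (f + g).
Proof.
move=> [k fk] [l gl]; exists (k + l)%N; rewrite exprDn mulr_suml big1// => i _.
rewrite mulrnAl; suff -> : f ^+ (k + l - i) * g ^+ i * e = 0 by rewrite mul0rn.
case: (leqP l i) => [li|/ltnW il].
  by rewrite -(subnK li) exprD mulrA -mulrA gl mulr0.
rewrite -addnBA// exprD (_ : _ * e = f ^+ (l - i) * g ^+ i * (f ^+ k * e)); last by ring.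
by rewrite fk mulr0.
Qed.

Lemma nil_onN e f : nil_on e f -> nil_on e (- f).
Proof. by rewrite -mulN1r; exact: nil_onM. Qed.

Lemma nil_onB e f g : nil_on e f -> nil_on e g -> nil_on e (f - g).
Proof. by move=> ef eg; apply/nil_onD/nil_onN. Qed.

Lemma nil_on_sum e I (s : seq I) (P : pred I) (F : I -> A) :
  (forall i, P i -> nil_on e (F i)) -> nil_on e (\sum_(i <- s | P i) F i).
Proof.
by move=> FP; apply: big_ind => //; [exact: nil_on0|exact: nil_onD].
Qed.

Lemma unit_on_regular e f : unit_on e f -> regular_on e f.
Proof.
move=> [c ce] h fh0; rewrite -ce (_ : h * _ = c * (f * h * e)); last by ring.
by rewrite fh0 mulr0.
Qed.

Lemma regular_on_nil e f : regular_on e f -> nil_on e f -> e = 0.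
Proof.
move=> freg [k]; elim: k => [|k IHk]; first by rewrite expr0 mul1r.
by rewrite exprS => /freg.
Qed.

Lemma regular_onM e f g : regular_on e f -> regular_on e g -> regular_on e (f * g).
Proof. by move=> freg greg h; rewrite -(mulrA f) => /freg/greg. Qed.

Lemma regular_onX e f k : regular_on e f -> regular_on e (f ^+ k).
Proof.
move=> freg; elim: k => [|k IHk] h; first by rewrite expr0 mul1r.
by rewrite exprS -(mulrA f) => /freg/IHk.
Qed.

Lemma unit_on_1 e f : e * e = e -> nil_on e f -> unit_on e (1 - f).
Proof.
move=> ee [k fk]; exists (\sum_(i < k) f ^+ i).
have := subrX1 f k; move: (\sum_(i < k) _) => s fs.
rewrite (_ : s * (1 - f) * e = e - (f ^+ k - 1 + 1) * e); last by rewrite fs; ring.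
by rewrite subrK fk subr0.
Qed.

End OnIdempotent.

Section OrthogonalIdempotents.
Variable A : comPzRingType.

Definition orthogonal_idempotents (I : finType) (e : I -> A) : Prop :=
  forall i j, e i * e j = if i == j then e i else 0.

(** The index set is an arbitrary finite type so that two decompositions can be
    put side by side on a sum type; some [e i] may be zero. *)
Definition decomposition (good : A -> Prop) (e0 : A) : Prop :=
  exists (I : finType) (e : I -> A),
    [/\ orthogonal_idempotents e, \sum_i e i = e0 & forall i, good (e i)].

Variables (I : finType) (e : I -> A).
Hypothesis e_orth : orthogonal_idempotents e.

Lemma orth_idem i : e i * e i = e i. Proof. by rewrite e_orth eqxx. Qed.

Lemma orth_sum i (F : I -> A) : (\sum_j F j * e j) * e i = F i * e i.
Proof.
rewrite mulr_suml (bigD1 i)//= -mulrA orth_idem big1 ?addr0// => j /negPf ji.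
by rewrite -mulrA e_orth ji mulr0.
Qed.

Hypothesis e_sum : \sum_i e i = 1.

Lemma orth_eq0 x : (forall i, x * e i = 0) -> x = 0.
Proof. by move=> x0; rewrite -[x]mulr1 -e_sum mulr_sumr big1. Qed.

End OrthogonalIdempotents.

Section LocalDecomposition.
Variable A : comPzRingType.
Hypothesis Adcc : principal_dcc A.

Definition primitive (e : A) : Prop :=
  e * e = e /\ forall f, f * f = f -> f * e = 0 \/ f * e = e.

(** A decreasing chain of idempotents is its own chain of products. *)
Lemma dcc_idempotents (e : nat -> A) : (forall k, e k * e k = e k) ->
    (forall k, e k.+1 = e k.+1 * e k) -> exists k, e k.+1 = e k.
Proof.
move=> e_idem e_dec.
have prodE k : \prod_(0 <= i < k.+1) e i = e k.
  elim: k => [|k IHk]; first by rewrite big_nat1.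
  by rewrite big_nat_recr//= IHk mulrC -e_dec.
have [N NP] := Adcc e; exists N; have [c] := NP N.+2.
move=> /(congr1 ( *%R (e N))); rewrite prodE mulrCA (mulrC (e N) (e N.+1)) -e_dec.
have -> : e N * \prod_(0 <= i < N) e i = e N.
  case: N {NP c} => [|N]; first by rewrite big_geq// mulr1.
  by rewrite prodE -e_dec.
by move=> eN; rewrite e_dec eN mulrCA e_idem.
Qed.

(** If [1] had no decomposition, one could split off again and again a part
    without decomposition, giving an infinite strictly decreasing chain of
    idempotents. *)
Lemma primitive_decomposition : decomposition primitive 1.
Proof.
apply: contrapT => bad1.
pose bad := {e : A | e * e = e /\ ~ decomposition primitive e}.
have step (x : bad) : exists y : bad, sval y = sval y * sval x /\ sval y <> sval x.
  case: x => e [ee ebad] /=.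
  have [f [ff [fe0 fee]]] : exists f, f * f = f /\ f * e <> 0 /\ f * e <> e.
    apply: contrapT => no_f; apply: ebad; exists unit, (fun=> e); split=> [[] []//||_].
      by rewrite big_const card_unit /= addr0.
    split=> // f ff; apply: contrapT => /not_orP fP; apply: no_f.
    by exists f; case: fP.
  have sub_idem g : g * g = g -> g * e * (g * e) = g * e.
    by move=> gg; rewrite mulrACA gg ee.
  have sub_dec g : g * g = g -> g * e = g * e * e by rewrite -mulrA ee.
  have f'f' : (1 - f) * (1 - f) = 1 - f.
    by rewrite mulrBl mul1r mulrBr mulr1 ff subrr subr0.
  have [[I [u [u_orth u_sum u_prim]]]|fbad] :=
      pselect (decomposition primitive (f * e)); last first.
    by exists (exist _ (f * e) (conj (sub_idem _ ff) fbad)); split=> //=; exact: sub_dec.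
  have [[J [v [v_orth v_sum v_prim]]]|fbad] :=
      pselect (decomposition primitive ((1 - f) * e)); last first.
    exists (exist _ ((1 - f) * e) (conj (sub_idem _ f'f') fbad)).
    split=> /=; first exact: sub_dec.
    by move/eqP; rewrite mulrBl mul1r -subr_eq0 addrC addKr oppr_eq0 => /eqP.
  case: ebad; exists (I + J)%type, (fun k => match k with inl i => u i | inr j => v j end).
  have u_sub i : u i * f = u i.
    have -> : u i = u i * (f * e).
      rewrite -u_sum mulr_sumr (bigD1 i)//= u_orth eqxx big1 ?addr0// => j.
      by move=> /negPf; rewrite u_orth eq_sym => ->.
    by rewrite -mulrA (mulrAC f) ff.
  have v_sub j : v j * f = 0.
    have -> : v j = v j * ((1 - f) * e).
      rewrite -v_sum mulr_sumr (bigD1 j)//= v_orth eqxx big1 ?addr0// => i.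
      by move=> /negPf; rewrite v_orth eq_sym => ->.
    by rewrite -mulrA (mulrAC (1 - f)) mulrBl mul1r ff subrr mul0r mulr0.
  have uv i j : u i * v j = 0 by rewrite -u_sub -mulrA [f * _]mulrC v_sub mulr0.
  have inl_inj : injective (@inl I J) by move=> ? ? [].
  have inr_inj : injective (@inr I J) by move=> ? ? [].
  split=> [[i|i] [j|j]||[i|i]].
  - by rewrite u_orth (inj_eq inl_inj).
  - exact: uv.
  - by rewrite mulrC uv.
  - by rewrite v_orth (inj_eq inr_inj).
  - by rewrite big_sumType /= u_sum v_sum -mulrDl addrCA subrr addr0 mul1r.
  - exact: u_prim.
  - exact: v_prim.
have [next nextP] := choice step.
pose e k := iter k next (exist _ 1 (conj (mulr1 1) bad1) : bad).
have [k] := @dcc_idempotents (sval \o e) (fun k => (svalP (e k)).1) (fun k => (nextP (e k)).1).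
exact: (nextP (e k)).2.
Qed.

Lemma dcc_regular_unit (a : A) : GRing.lreg a -> exists c, c * a = 1.
Proof.
move=> areg; have [N NP] := Adcc (fun=> a); have [c] := NP N.+1.
rewrite !prodr_const_nat !subn0 => aN; exists c.
elim: N {NP} aN => [|N IHN]; first by rewrite expr0 expr1.
by rewrite exprS [in RHS]exprS mulrCA => /areg /IHN.
Qed.

(** Some power of [f] is a multiple of its own square, so an idempotent multiple
    [g] of that power acts on it as the identity; primitivity of [e] decides whether
    [g] is zero or one on [e]. For T-nilpotence, past the stabilization index
    the product [p] satisfies [p = d * f j * p] with [f j] nilpotent. *)
Lemma primitive_local e : primitive e ->
  (forall f, nil_on e f \/ unit_on e f) /\ t_nilpotent_on e.
Proof.
move=> [ee e_prim]; split=> [f|f f_nil].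
  have [N NP] := Adcc (fun=> f); have [c] := NP (N.+1 + N.+1)%N.
  have prodE k : \prod_(0 <= i < k) f = f ^+ k by rewrite prodr_const_nat subn0.
  move=> /(congr1 ( *%R f)); rewrite !prodE -exprS mulrCA exprD => fN.
  pose g := c * f * f ^+ N.+1.
  have gf : g * f ^+ N.+1 = f ^+ N.+1 by rewrite {2}fN /g -!mulrA.
  have gg : g * g = g by rewrite {2}/g mulrCA gf.
  case: (e_prim g gg) => ge; [left|right].
    by exists N.+1; rewrite -gf mulrAC ge mul0r.
  by exists (c * f * f ^+ N); rewrite -[RHS]ge /g exprSr !mulrA.
have [N NP] := Adcc f; have [j [Nj [k fk]]] := f_nil N; have [c cP] := NP j.+1.
exists N; set p := \prod_(0 <= i < N) f i in cP *.
have [d dP] : exists d, p = d * f j * p.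
  exists (c * \prod_(N <= i < j) f i); rewrite {1}cP big_nat_recr//=.
  by rewrite (big_cat_nat (leq0n N) Nj) -/p /=; ring.
have pk l : p = (d * f j) ^+ l * p.
  by elim: l => [|l IHl]; rewrite ?mul1r// exprS -mulrA -IHl.
by rewrite (pk k) exprMn mulrAC -(mulrA _ _ e) fk mulr0 mul0r.
Qed.

End LocalDecomposition.

(** * Flat modules over a ring with the descending chain condition *)

(** Congruence modulo an ideal passes to each term of the Leibniz formula. *)
Lemma nil_on_det (A : comPzRingType) (e : A) r (B C : 'M[A]_r) :
  (forall i j, nil_on e (B i j - C i j)) -> nil_on e (\det B - \det C).
Proof.
move=> BC; rewrite /determinant -sumrB; apply: nil_on_sum => s _.
rewrite -mulrBr; apply: nil_onM; apply: (big_rec2 (fun x y => nil_on e (x - y))).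
  by rewrite subrr; exact: nil_on0.
move=> i x y _ xy; rewrite (_ : _ - _ = B i (s i) * (x - y) + y * (B i (s i) - C i (s i))).
  by apply: nil_onD; exact: nil_onM.
by ring.
Qed.

Section LocalBasis.
Variables (A : comPzRingType) (M : lmodType A) (e : A).
Hypothesis ee : e * e = e.
Hypothesis e_local : forall f, nil_on e f \/ unit_on e f.
Hypothesis e_tnil : t_nilpotent_on e.
Hypothesis Mflat : flat M.

Definition lincomb (l : seq (A * M)) : M := \sum_(p <- l) p.1 *: p.2.

Definition in_span (B : set M) (x : M) : Prop :=
  exists l, (forall p, p \in l -> B p.2) /\ x = lincomb l.

(** The submodule [mM], where [m] is the ideal of elements nilpotent on [e]. It
    contains [(1 - e)M], so that [M/mM] is [eM] modulo the maximal ideal of [eA]. *)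
Definition in_nilM (x : M) : Prop :=
  exists l, (forall p : A * M, p \in l -> nil_on e p.1) /\ x = lincomb l.

(** Linear independence of [B] in the vector space [M/mM] over the residue field
    of [eA]. *)
Definition free_mod_nil (B : set M) : Prop := forall (s : seq M) (a : M -> A),
  uniq s -> (forall y, y \in s -> B y) -> in_nilM (\sum_(y <- s) a y *: y) ->
  forall y, y \in s -> nil_on e (a y).

Lemma lincomb_cat l l' : lincomb (l ++ l') = lincomb l + lincomb l'.
Proof. by rewrite /lincomb big_cat. Qed.

Lemma lincombZ a l : lincomb [seq (a * p.1, p.2) | p <- l] = a *: lincomb l.
Proof.
rewrite /lincomb big_map scaler_sumr; apply: eq_bigr => p _.
by rewrite scalerA.
Qed.

Lemma lincomb_group (N : lmodType A) (n : M -> N) (l : seq (A * M)) (s : seq M) :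
    uniq s -> (forall p, p \in l -> p.2 \in s) ->
  \sum_(p <- l) p.1 *: n p.2 = \sum_(y <- s) (\sum_(p <- l | p.2 == y) p.1) *: n y.
Proof.
move=> s_uniq ls; under [RHS]eq_bigr => y _ do rewrite scaler_suml.
rewrite (exchange_big_dep predT)//= big_seq [RHS]big_seq.
apply: eq_bigr => p /ls ps; rewrite big_mkcond (bigD1_seq p.2)//= eqxx.
by rewrite big1 ?addr0// => y /negPf; rewrite eq_sym => ->.
Qed.

Lemma in_span0 B : in_span B 0.
Proof. by exists [::]; rewrite /lincomb big_nil. Qed.

Lemma in_spanD B x y : in_span B x -> in_span B y -> in_span B (x + y).
Proof.
move=> [l [lB ->]] [l' [lB' ->]]; exists (l ++ l'); rewrite lincomb_cat.
by split=> // p; rewrite mem_cat => /orP[/lB|/lB'].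
Qed.

Lemma in_spanZ B a x : in_span B x -> in_span B (a *: x).
Proof.
move=> [l [lB ->]]; exists [seq (a * p.1, p.2) | p <- l]; rewrite lincombZ.
by split=> // _ /mapP[p /lB pB ->].
Qed.

Lemma in_nilMD x y : in_nilM x -> in_nilM y -> in_nilM (x + y).
Proof.
move=> [l [lB ->]] [l' [lB' ->]]; exists (l ++ l'); rewrite lincomb_cat.
by split=> // p; rewrite mem_cat => /orP[/lB|/lB'].
Qed.

Lemma in_nilMZ a x : in_nilM x -> in_nilM (a *: x).
Proof.
move=> [l [lB ->]]; exists [seq (a * p.1, p.2) | p <- l]; rewrite lincombZ.
by split=> // _ /mapP[p /lB pB ->]; exact: nil_onM.
Qed.

Lemma nil_in_nilM a x : nil_on e a -> in_nilM (a *: x).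
Proof.
move=> a_nil; exists [:: (a, x)]; rewrite /lincomb big_seq1.
by split=> // p; rewrite inE => /eqP->.
Qed.

Lemma nil_on_compl : nil_on e (1 - e).
Proof. by exists 1%N; rewrite expr1 mulrBl mul1r ee subrr. Qed.

Lemma maximal_free : exists B, free_mod_nil B /\
  forall C, (B `<` C)%classic -> ~ free_mod_nil C.
Proof.
apply: Zorn_bigcup => F F_free F_total s a s_uniq sF ax.
have [->//|[y0 y0s]] : s = [::] \/ exists y0, y0 \in s.
  by case: (s) => [|y0 t]; [left|right; exists y0; rewrite mem_head].
suff [X FX Xs] : exists2 X, F X & forall y, y \in s -> X y.
  exact: (F_free _ FX) ax.
have [X0 FX0 _] := sF y0 y0s.
elim: s {s_uniq ax y0 y0s} sF => [|y s IHs] sF; first by exists X0.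
have [X FX Xy] := sF y (mem_head _ _).
have [|Y FY Ys] := IHs; first by move=> z zs; apply: sF; rewrite inE zs orbT.
have [XY|YX] := F_total X Y FX FY.
  by exists Y => // z; rewrite inE => /orP[/eqP->|/Ys//]; exact: XY.
by exists X => // z; rewrite inE => /orP[/eqP->//|/Ys]; exact: YX.
Qed.

Section MaximalFree.
Variable B : set M.
Hypothesis B_free : free_mod_nil B.
Hypothesis B_max : forall C, (B `<` C)%classic -> ~ free_mod_nil C.

(** A vector that is independent of a maximal free family could be added to it;
    a nontrivial relation can be solved for the vector because elements which
    are not nilpotent on [e] are invertible there. *)
Lemma span_mod_nil x : exists s t, [/\ in_span B s, in_nilM t & x = s + t].
Proof.
apply: contrapT => x_bad.
have xB : ~ B x.
  move=> Bx; apply: x_bad; exists x, 0; split; last by rewrite addr0.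
    exists [:: (1, x)]; rewrite /lincomb big_seq1 scale1r; split=> // p.
    by rewrite inE => /eqP->.
  by exists [::]; rewrite /lincomb big_nil.
apply: (B_max (C := (B `|` [set x])%classic)).
  by split=> [y|]; [left|move=> /(_ x (or_intror erefl))].
move=> s a s_uniq sB ax.
have [xs|/negP xs] := boolP (x \in s); last first.
  apply: B_free => // y ys; have [//|yx] := sB y ys.
  by case: xs; rewrite -[x]yx.
have x_nil : nil_on e (a x).
  have [//|[c cx]] := e_local (a x); case: x_bad.
  exists ((- (c * e)) *: (\sum_(y <- rem x s) a y *: y)).
  exists ((c * e) *: (\sum_(y <- s) a y *: y) + (1 - e) *: x); split.
  - apply: in_spanZ; exists [seq (a y, y) | y <- rem x s].
    rewrite /lincomb big_map; split=> // p /mapP[y].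
    rewrite mem_rem_uniq// inE => /andP[yx ys] -> /=.
    by have [//|/eqP] := sB y ys; rewrite (negPf yx).
  - apply: in_nilMD; first exact: in_nilMZ.
    exact/nil_in_nilM/nil_on_compl.
  - rewrite (perm_big _ (perm_to_rem xs)) big_cons /= scalerDr scalerA.
    rewrite mulrAC cx -[LHS]scale1r -(subrK e 1) scalerDl scaleNr.
    by rewrite [in RHS](addrAC (e *: x)) [RHS]addrC addrK [RHS]addrC scaleNr (subrK (e *: x)).
move=> y; rewrite (perm_mem (perm_to_rem xs)) inE => /orP[/eqP->//|].
apply: B_free; first exact: rem_uniq.
  move=> z; rewrite mem_rem_uniq// inE => /andP[zx zs].
  by have [//|/eqP] := sB z zs; rewrite (negPf zx).
move: ax; rewrite (perm_big _ (perm_to_rem xs)) big_cons /= => ax.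
rewrite -[X in in_nilM X](addKr (a x *: x)) addrC; apply: in_nilMD => //.
by rewrite -scaleNr; exact/nil_in_nilM/nil_onN.
Qed.

(** Nakayama's lemma without finiteness assumption. If [e *: x] is outside the
    span, then writing [x] modulo the span as a combination with coefficients in
    [m] shows that one of its terms is outside as well. Iterating gives a
    sequence in [m] none of whose products vanishes on [e], against
    T-nilpotence. *)
Lemma span_local x : in_span B (e *: x).
Proof.
apply: contrapT => x_bad.
(* [z.1] is the product of the coefficients chosen so far, [z.2] the vector that
   it multiplies. *)
pose bad (z : A * M) := ~ in_span B ((z.1 * e) *: z.2).
have step (z : {z | bad z}) : exists y : A * M,
    nil_on e y.1 /\ bad ((sval z).1 * y.1, y.2).
  case: z => -[c y] /= y_bad; apply: contrapT => no_next; apply: y_bad.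
  have [s [_ [sB [l [l_nil ->]] ->]]] := span_mod_nil y.
  rewrite /= scalerDr; apply: in_spanD; first exact: in_spanZ.
  rewrite /lincomb scaler_sumr big_seq; apply: big_ind => [|u v|p pl].
  - exact: in_span0.
  - exact: in_spanD.
  - apply: contrapT => p_bad; apply: no_next; exists p; split; first exact: l_nil.
    by rewrite /bad /= mulrAC -scalerA.
have [next nextP] := choice step.
have bad1 : bad (1, x) by rewrite /bad /= mul1r.
pose z k := iter k (fun z => exist _ _ (nextP z).2 : {z | bad z}) (exist _ _ bad1).
pose f k := (next (z k)).1.
have zE k : (sval (z k)).1 = \prod_(0 <= i < k) f i.
  by elim: k => [|k IHk]; [rewrite big_geq|rewrite big_nat_recr//= -IHk].
have [N fN] := e_tnil (fun N => ex_intro _ N (conj (leqnn N) (nextP (z N)).1)).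
apply: (svalP (z N)); rewrite zE /f fN scale0r; exact: in_span0.
Qed.

(** By [flat_relation] a relation with coefficients [a] comes from expressions of
    the basis vectors through vectors [y j], and these are combinations of basis
    vectors by [span_local]. This gives a square matrix [G] with [a *m G = 0].
    By independence modulo [mM], [G] is congruent to the identity on [e], so its
    determinant is invertible on [e]. *)
Lemma free_local (s : seq M) (a : M -> A) : uniq s -> (forall y, y \in s -> B y) ->
  \sum_(y <- s) a y *: y = 0 -> forall y, y \in s -> a y * e = 0.
Proof.
move=> s_uniq sB as0.
have [J [c [y [ac sE]]]] : exists (J : finType) (c : J -> 'I_(size s) -> A) (y : J -> M),
    (forall j, \sum_(i < size s) a s`_i * c j i = 0) /\
    forall i : 'I_(size s), s`_i = \sum_j c j i *: y j.
  apply: flat_relation => //.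
  by rewrite -[RHS]as0 (big_nth 0) big_mkord.
have /choice[l lP] j := span_local (y j).
pose S := undup (s ++ flatten [seq [seq p.2 | p <- l j] | j <- enum J]).
have S_uniq : uniq S := undup_uniq _.
have sS z : z \in s -> z \in S by rewrite mem_undup mem_cat => ->.
have lS j p : p \in l j -> p.2 \in S.
  move=> pl; rewrite mem_undup mem_cat; apply/orP; right; apply/flattenP.
  exists [seq p.2 | p <- l j]; last exact: map_f.
  by apply/mapP; exists j; rewrite ?mem_enum.
have SB z : z \in S -> B z.
  rewrite mem_undup mem_cat => /orP[/sB//|/flattenP[_ /mapP[j _ ->] /mapP[p pl ->]]].
  exact: (lP j).1.
pose D j z := \sum_(p <- l j | p.2 == z) p.1.
have yE j : e *: y j = \sum_(z <- S) D j z *: z.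
  rewrite (lP j).2 /lincomb; apply: (lincomb_group id) => // p; exact: lS.
pose E (i : 'I_(size s)) z := \sum_j c j i * D j z.
have eE (i : 'I_(size s)) : e *: s`_i = \sum_(z <- S) E i z *: z.
  rewrite {1}sE scaler_sumr; under [RHS]eq_bigr => z _ do rewrite scaler_suml.
  rewrite exchange_big; apply: eq_bigr => j _ /=.
  rewrite scalerA mulrC -scalerA yE scaler_sumr.
  by apply: eq_bigr => z _; rewrite scalerA.
have aE z : \sum_(i < size s) a s`_i * E i z = 0.
  under eq_bigr => i _ do rewrite mulr_sumr.
  rewrite exchange_big big1//= => j _; under eq_bigr => i _ do rewrite mulrA.
  by rewrite -mulr_suml ac mul0r.
have E_nil (i : 'I_(size s)) z : z \in S -> nil_on e (E i z - (z == s`_i)%:R).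
  have is_s : s`_i \in s by rewrite mem_nth.
  pose t z := E i z - (z == s`_i)%:R * e => zS.
  rewrite (_ : _ - _ = t z + (z == s`_i)%:R * (- (1 - e))); last by rewrite /t; ring.
  apply: nil_onD; last exact/nil_onM/nil_onN/nil_on_compl.
  apply: (B_free S_uniq SB _ zS); exists [::]; split=> //.
  rewrite /lincomb big_nil /t; under eq_bigr => w _ do rewrite scalerBl.
  rewrite sumrB -eE (bigD1_seq s`_i) ?sS//= eqxx mul1r big1 ?addr0 ?subrr// => w /negPf->.
  by rewrite mul0r scale0r.
pose G : 'M[A]_(size s) := \matrix_(i, k) E i s`_k.
have G_unit : unit_on e (\det G).
  rewrite (_ : \det G = 1 - (1 - \det G)); last by ring.
  apply: unit_on_1 => //; rewrite -(opprB _ 1); apply: nil_onN.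
  rewrite -(det1 A (size s)); apply: nil_on_det => i j; rewrite !mxE.
  have -> : (i == j) = (s`_j == s`_i) by rewrite nth_uniq// eq_sym.
  by apply: E_nil; rewrite sS// mem_nth.
have [d dG] := G_unit.
pose v : 'rV[A]_(size s) := \row_i a s`_i.
have vG : v *m G = 0.
  by apply/rowP => k; rewrite !mxE -[RHS](aE s`_k); apply: eq_bigr => i _; rewrite !mxE.
have : \det G *: v = 0.
  by rewrite -mul_mx_scalar -mul_mx_adj mulmxA vG mul0mx.
move=> /rowP v0 z zs.
have iz : (index z s < size s)%N by rewrite index_mem.
have := v0 (Ordinal iz); rewrite !mxE nth_index// => {v0}.
move: (\det G) dG => g dG az.
rewrite -dG (_ : a z * (d * g * e) = d * e * (g * a z)); last by ring.
by rewrite az mulr0.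
Qed.

End MaximalFree.

(** The uniqueness of coordinates is stated in the form in which it defines
    linear maps: prescribing values [n] on [B] is compatible with all relations,
    also for lists in which a vector is repeated. *)
Lemma local_basis : exists B : set M, (forall x, in_span B (e *: x)) /\
  forall (N : lmodType A) (n : M -> N) (l : seq (A * M)),
    (forall p, p \in l -> B p.2) -> lincomb l = 0 ->
    \sum_(p <- l) (p.1 * e) *: n p.2 = 0.
Proof.
have [B [B_free B_max]] := maximal_free.
exists B; split=> [x|N n l lB l0]; first exact: span_local.
pose s := undup [seq p.2 | p <- l].
have s_uniq : uniq s := undup_uniq _.
have ls p : p \in l -> p.2 \in s by move=> pl; rewrite mem_undup map_f.
have sB y : y \in s -> B y by rewrite mem_undup => /mapP[p /lB pB ->].
under eq_bigr => p _ do rewrite mulrC -scalerA.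
rewrite -scaler_sumr (lincomb_group n s_uniq ls) scaler_sumr big_seq big1// => y ys.
pose a z := \sum_(p <- l | p.2 == z) p.1.
have as0 : \sum_(z <- s) a z *: z = 0 by rewrite -(lincomb_group id s_uniq ls).
by rewrite scalerA mulrC (free_local B_free B_max s_uniq sB as0 ys) scale0r.
Qed.

End LocalBasis.

(** Each local piece of a flat module has a basis; a linear map is lifted by
    choosing preimages of the images of the basis vectors. *)
Theorem dcc_perfect (A : comPzRingType) : principal_dcc A -> perfect A.
Proof.
move=> Adcc M Mflat N N' g g_surj h.
have [I [e [e_orth e_sum e_prim]]] := primitive_decomposition Adcc.
have e_local i := primitive_local Adcc (e_prim i).
have /choice[B BP] i := local_basis (e_prim i).1 (e_local i).1 (e_local i).2 Mflat.
have /choice[L LP] i : exists L : M -> seq (A * M), forall x,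
    (forall p, p \in L x -> B i p.2) /\ e i *: x = lincomb (L x).
  by have [L LP] := choice (BP i).1; exists L.
have [sec secK] := choice g_surj.
pose n y := sec (h y).
pose ev i (l : seq (A * M)) := \sum_(p <- l) (p.1 * e i) *: n p.2.
have ev_eq i l l' : (forall p, p \in l -> B i p.2) -> (forall p, p \in l' -> B i p.2) ->
    lincomb l = lincomb l' -> ev i l = ev i l'.
  move=> lB lB' ll'; apply/eqP; rewrite -subr_eq0; apply/eqP.
  transitivity (ev i (l ++ [seq (-1 * p.1, p.2) | p <- l'])).
    rewrite /ev big_cat big_map /=; congr (_ + _); rewrite -sumrN.
    by apply: eq_bigr => p _; rewrite mulN1r mulNr scaleNr.
  apply: (BP i).2; last by rewrite lincomb_cat lincombZ scaleN1r ll' subrr.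
  by move=> p; rewrite mem_cat => /orP[/lB//|/mapP[q /lB' qB ->]].
pose k x := \sum_i ev i (L i x).
have k_lin : linear k.
  move=> a x y; rewrite /k scaler_sumr -big_split; apply: eq_bigr => i _ /=.
  rewrite (ev_eq _ _ ([seq (a * p.1, p.2) | p <- L i x] ++ L i y)).
  - rewrite /ev big_cat big_map scaler_sumr; congr (_ + _).
    by apply: eq_bigr => p _; rewrite scalerA mulrA.
  - exact: (LP i _).1.
  - move=> p; rewrite mem_cat => /orP[/mapP[q qL ->]|/(LP i _).1//].
    exact: ((LP i x).1 q qL).
  - by rewrite lincomb_cat lincombZ -!(LP i _).2 scalerDr !scalerA mulrC.
exists (linear_fun k_lin) => x; rewrite -[LHS]/(g (k x)) /k linear_sum.
rewrite -[x in RHS]scale1r -e_sum scaler_suml linear_sum; apply: eq_bigr => i _.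
rewrite linear_sum -[in RHS](e_prim i).1 -scalerA (LP i x).2 /lincomb scaler_sumr linear_sum.
by apply: eq_bigr => p _; rewrite !linearZ /= secK mulrC scalerA.
Qed.

(** * Primary rings, their polynomial rings and total quotient rings *)

Lemma lreg_eq0 (A : comPzRingType) (a h : A) : GRing.lreg a -> a * h = 0 -> h = 0.
Proof. by move=> areg ah; apply: areg; rewrite ah mulr0. Qed.

Lemma lregI (A : comPzRingType) (a : A) : (forall h, a * h = 0 -> h = 0) -> GRing.lreg a.
Proof.
move=> areg x y /eqP; rewrite -subr_eq0 -mulrBr => /eqP/areg/eqP.
by rewrite subr_eq0 => /eqP.
Qed.

Lemma lreg_prod (A : comPzRingType) I (s : seq I) (P : pred I) (F : I -> A) :
  (forall i, P i -> GRing.lreg (F i)) -> GRing.lreg (\prod_(i <- s | P i) F i).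
Proof.
by move=> FP; apply: big_ind => //; [exact: GRing.lreg1|exact: GRing.lregM].
Qed.

(** On [eA] each element is nilpotent or regular, and the nilpotents are
    T-nilpotent: this is what remains of a local factor of a ring with the
    descending chain condition after adjoining variables. *)
Definition primary (A : comPzRingType) (e : A) : Prop :=
  (forall f, nil_on e f \/ regular_on e f) /\ t_nilpotent_on e.

Definition primary_ring (A : comPzRingType) : Prop := decomposition (@primary A) 1.

Lemma dcc_primary_ring (A : comPzRingType) : principal_dcc A -> primary_ring A.
Proof.
move=> Adcc; have [I [e [e_orth e_sum e_prim]]] := primitive_decomposition Adcc.
exists I, e; split=> // i; have [e_loc e_tnil] := primitive_local Adcc (e_prim i).
by split=> // f; have [?|/unit_on_regular] := e_loc f; [left|right].
Qed.

Section RegularCombination.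
Variables (A : comPzRingType) (I : finType) (e : I -> A).
Hypothesis e_orth : orthogonal_idempotents e.
Hypothesis e_sum : \sum_i e i = 1.

(** Regularity can be tested and arranged separately on the members of an
    orthogonal decomposition of [1]. *)
Lemma lreg_sum (c : I -> A) : (forall i, regular_on (e i) (c i)) ->
  GRing.lreg (\sum_i c i * e i).
Proof.
move=> creg; apply: lregI => h ch; apply: (orth_eq0 e_sum) => i; apply: (creg i).
by rewrite mulrAC -(orth_sum e_orth) mulrAC ch mul0r.
Qed.

End RegularCombination.

(** The descending chain condition on principal ideals of the total quotient
    ring, expressed in the ring itself. *)
Definition regular_dcc (A : comPzRingType) : Prop :=
  forall a : nat -> A, exists N, forall k, exists t c, GRing.lreg t /\
    t * \prod_(0 <= i < N) a i = c * \prod_(0 <= i < k) a i.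

(** On each piece, either infinitely many factors are nilpotent and the product
    vanishes, or all factors from some point on are regular and can serve as
    denominators. *)
Theorem primary_regular_dcc (A : comPzRingType) : primary_ring A -> regular_dcc A.
Proof.
move=> [I [e [e_orth e_sum e_prim]]] f.
have /choice[K KP] i : exists K, \prod_(0 <= j < K) f j * e i = 0 \/
    forall j, (K <= j)%N -> regular_on (e i) (f j).
  have [[K KP]|no_K] := pselect (exists K, forall j, (K <= j)%N -> regular_on (e i) (f j)).
    by exists K; right.
  have [|K KP] := (e_prim i).2 f; last by exists K; left.
  move=> K; apply: contrapT => no_j; apply: no_K; exists K => j Kj.
  by have [fj|//] := (e_prim i).1 (f j); case: no_j; exists j.
pose N := \max_i K i.
have NK i : (K i <= N)%N by exact: leq_bigmax.
exists N => k; have [kN|/ltnW Nk] := leqP k N.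
  exists 1, (\prod_(k <= i < N) f i); split; first exact: GRing.lreg1.
  by rewrite mul1r (big_cat_nat (leq0n k) kN) mulrC.
set p := \prod_(0 <= j < N) f j.
pose u := \prod_(N <= j < k) f j.
pose t i := if pselect (p * e i = 0) then 1 else u.
pose c i := if pselect (p * e i = 0) then 0 else 1 : A.
exists (\sum_i t i * e i), (\sum_i c i * e i); split.
  apply: lreg_sum => // i h; rewrite /t; case: pselect => pe; rewrite ?mul1r//.
  move: h; rewrite -/(regular_on _ _); have [Kp|freg] := KP i.
    case: pe; rewrite /p (big_cat_nat (leq0n (K i)) (NK i)) /=.
    by rewrite mulrAC Kp mul0r.
  rewrite /u big_nat; apply: big_ind => [h|x y|j /andP[Nj _]].
  - by rewrite mul1r.
  - exact: regular_onM.
  - exact/freg/(leq_trans (NK i)).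
apply/eqP; rewrite -subr_eq0; apply/eqP/(orth_eq0 e_sum) => i.
rewrite mulrBl ![_ * _ * e i]mulrAC !(orth_sum e_orth) /t /c.
have -> : \prod_(0 <= j < k) f j = p * u by rewrite /p /u -big_cat_nat.
case: pselect => pe /=; last by ring.
by rewrite mul0r mul0r subr0 mul1r mulrC.
Qed.

Section TotalQuotient.
Variable A : comPzRingType.
Notation Q := (total_quotient A).

Definition to_quotient (a : A) : Q := fraction a (@GRing.lreg1 A).

Lemma to_quotient_zmod : zmod_morphism to_quotient.
Proof.
move=> a b; have toD x y : to_quotient (x + y) = to_quotient x + to_quotient y.
  by rewrite /to_quotient fractionD; apply/eqP; rewrite eq_fraction !mulr1.
by apply/eqP; rewrite eq_sym subr_eq eq_sym -toD subrK.
Qed.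

Lemma to_quotient_monoid : monoid_morphism to_quotient.
Proof.
split=> // a b; rewrite /to_quotient fractionM; apply/eqP.
by rewrite eq_fraction !mulr1.
Qed.

HB.instance Definition _ :=
  GRing.isZmodMorphism.Build A Q to_quotient to_quotient_zmod.
HB.instance Definition _ :=
  GRing.isMonoidMorphism.Build A Q to_quotient to_quotient_monoid.

Lemma to_quotient_inj : injective to_quotient.
Proof. by move=> a b /eqP; rewrite eq_fraction !mulr1 => /eqP. Qed.

Lemma to_quotient_inv s : GRing.lreg s -> exists v : Q, v * to_quotient s = 1.
Proof.
move=> hs; exists (fraction 1 hs); rewrite /to_quotient fractionM -fraction1.
by apply/eqP; rewrite eq_fraction !mulr1 !mul1r.
Qed.

Lemma quotient_fraction (x : Q) : exists a s,
  GRing.lreg s /\ x * to_quotient s = to_quotient a.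
Proof.
have [a [s [hs ->]]] := fractionP x; exists a, s; split=> //.
rewrite /to_quotient fractionM; apply/eqP.
by rewrite eq_fraction !mulr1.
Qed.

Theorem regular_dcc_quotient : regular_dcc A -> principal_dcc Q.
Proof.
move=> Adcc x.
have /choice[b /choice[s bsP]] i := quotient_fraction (x i).
have [N NP] := Adcc b; exists N => k; have [t [c [treg tc]]] := NP k.
have bs m : (\prod_(0 <= i < m) x i) * to_quotient (\prod_(0 <= i < m) s i) =
    to_quotient (\prod_(0 <= i < m) b i).
  by rewrite !rmorph_prod -big_split /=; apply: eq_bigr => i _; rewrite (bsP i).2.
have sreg m : GRing.lreg (\prod_(0 <= i < m) s i).
  by apply: lreg_prod => i _; exact: (bsP i).1.
have [v vs] := to_quotient_inv (sreg N); have [w wt] := to_quotient_inv treg.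
exists (v * w * to_quotient c * to_quotient (\prod_(0 <= i < k) s i)).
move: (congr1 to_quotient tc); rewrite !rmorphM /= -!bs.
move: (to_quotient t) (to_quotient c) wt => T C wT TC.
rewrite (_ : v * w * C * _ * _ = v * w * (C * (\prod_(0 <= i < k) x i *
  to_quotient (\prod_(0 <= i < k) s i)))); last by ring.
move: (to_quotient _) vs TC => S vS <-.
rewrite (_ : _ * _ = (v * S) * (w * T) * \prod_(0 <= i < N) x i); last by ring.
by rewrite vS wT !mul1r.
Qed.

End TotalQuotient.

Section CoefTop.
Variable P : comNzRingType.
Implicit Types p q : {poly P}.

Lemma coef_topM p q m n : (size p <= m.+1)%N -> (size q <= n.+1)%N ->
  (p * q)`_(m + n) = p`_m * q`_n.
Proof.
move=> pm qn; rewrite coefM (bigD1 (inord m)) //= inordK ?ltnS ?leq_addr//.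
rewrite addKn big1 ?addr0// => i im.
have {im} im : (i : nat) != m 
  by apply: contraNneq im => im; apply/eqP/val_inj; rewrite /= inordK ?ltnS ?leq_addr.
have [mi|im'] := ltnP m i.
  by rewrite nth_default ?mul0r// (leq_trans pm).
rewrite [q`__]nth_default ?mulr0// (leq_trans qn)//.
by rewrite ltn_subRL ltn_add2r ltn_neqAle im.
Qed.

Lemma size_topM p q m n : (size p <= m.+1)%N -> (size q <= n.+1)%N ->
  (size (p * q)%R <= (m + n).+1)%N.
Proof.
move=> pm qn; apply: leq_trans (size_polyMleq _ _) _.
by rewrite -subn1 leq_subLR (leq_trans (leq_add pm qn))// addSn addnS.
Qed.

Lemma top_exp p m k : (size p <= m.+1)%N ->
  (size (p ^+ k)%R <= (m * k).+1)%N /\ (p ^+ k)`_(m * k) = p`_m ^+ k.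
Proof.
move=> pm; elim: k => [|k [sk ck]]; first by rewrite muln0 expr0 size_poly1 coef1.
by rewrite exprS mulnS size_topM// coef_topM// ck -exprS.
Qed.

End CoefTop.

Section PrimaryPoly.
Variables (P : comNzRingType) (e : P).
Hypothesis ee : e * e = e.
Hypothesis e_prim : primary e.

Definition regular_top (q : {poly P}) (D : nat) : Prop :=
  [/\ (size q <= D.+1)%N & regular_on e q`_D].

Lemma nil_on_polyC c : nil_on e c -> nil_on e%:P c%:P.
Proof. by move=> [k ck]; exists k; rewrite -rmorphXn -polyCM ck. Qed.

(** Induction on the degree. If the top coefficient is nilpotent on [e], remove
    it; a power of the truncated polynomial is a multiple of [f] up to a power
    of the removed term, which vanishes on [e] for a large exponent. *)
Lemma poly_dichotomy (f : {poly P}) :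
  (forall i, nil_on e f`_i) \/ exists g D, regular_top (f * g * e%:P) D.
Proof.
move: {2}(size f) (leqnn (size f)) => n; elim: n f => [|n IHn] f fn.
  left=> i; move: fn; rewrite leqn0 size_poly_eq0 => /eqP->.
  by rewrite coef0; exact: nil_on0.
have [c_nil|c_reg] := e_prim.1 f`_n; last first.
  right; exists 1, n; split; rewrite mulr1.
    by rewrite mulrC mul_polyC (leq_trans (size_scale_leq _ _)).
  by rewrite coefMC => h; rewrite [_ * e * h]mulrAC -(mulrA _ e e) ee => /c_reg.
pose u := (f`_n)%:P * 'X^n.
have f'n : (size (f - u)%R <= n)%N.
  apply/leq_sizeP => j; rewrite leq_eqVlt => /orP[/eqP<-|nj].
    by rewrite coefB coefCM coefXn eqxx mulr1 subrr.
  by rewrite coefB coefCM coefXn gtn_eqF// mulr0 subr0 nth_default// (leq_trans fn).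
have [f'_nil|[g [D [gD g_reg]]]] := IHn _ f'n.
  left=> i; rewrite -(subrK u f) coefD; apply: nil_onD => //.
  by rewrite coefCM mulrC; exact: nil_onM.
have [k uk] : nil_on e%:P (- u).
  by apply: nil_onN; rewrite /u mulrC; exact/nil_onM/nil_on_polyC.
have := subrXX (f - u) (- u) k.+1; rewrite opprK subrK.
move: (\sum_(i < _) _) => w fw.
right; exists (w * g ^+ k.+1), (D * k.+1)%N.
have -> : f * (w * g ^+ k.+1) * e%:P = ((f - u) * g * e%:P) ^+ k.+1.
  have eX m : e%:P ^+ m.+1 = e%:P.
    by elim: m => [|m IHm]; rewrite ?expr1// exprS IHm -polyCM ee.
  rewrite !exprMn eX mulrA -fw.
  rewrite (_ : _ * e%:P = (f - u) ^+ k.+1 * g ^+ k.+1 * e%:P -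
    (- u) * g ^+ k.+1 * ((- u) ^+ k * e%:P)).
    by rewrite uk mulr0 subr0.
  by rewrite [(- u) ^+ k.+1]exprS; ring.
have [sk ck] := top_exp k.+1 gD; split=> //.
by rewrite ck; exact: regular_onX.
Qed.

Lemma regular_top_regular (f g : {poly P}) D :
  regular_top (f * g * e%:P) D -> regular_on e%:P f.
Proof.
move=> [qD q_reg] h fh; set q := f * g * e%:P in qD q_reg.
set w := h * e%:P.
have qw : q * w = 0.
  rewrite /q /w (_ : _ * _ = f * h * e%:P * (g * e%:P)); last by ring.
  by rewrite fh mul0r.
have we : w * e%:P = w by rewrite /w -mulrA -polyCM ee.
apply/eqP; rewrite -lead_coef_eq0; apply/eqP.
have lead_e : lead_coef w * e = lead_coef w by rewrite /lead_coef -coefMC we.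
rewrite -lead_e; apply: q_reg; rewrite -mulrA lead_e.
have [->|w0] := eqVneq w 0; first by rewrite lead_coef0 mulr0.
by rewrite /lead_coef -coef_topM ?qw ?coef0// prednK// size_poly_gt0.
Qed.

Lemma poly_coef_nil (f : {poly P}) : nil_on e%:P f -> forall i, nil_on e f`_i.
Proof.
move=> f_nil i; have [//|[g [D /regular_top_regular f_reg]]] := poly_dichotomy f.
have /polyC_inj e0 := regular_on_nil f_reg f_nil.
by exists 0%N; rewrite e0 mulr0.
Qed.

Lemma coef_poly_nil (f : {poly P}) : (forall i, nil_on e f`_i) -> nil_on e%:P f.
Proof.
move=> f_nil; rewrite -[f]coefK poly_def; apply: nil_on_sum => i _.
by rewrite -mul_polyC mulrC; exact/nil_onM/nil_on_polyC.
Qed.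

(** A Koenig-type argument: if no product of the polynomials vanishes on [e], one
    can choose one coefficient from each in such a way that the remaining tails
    of the product still do not vanish, so that the chosen coefficients, which
    are nilpotent infinitely often, contradict T-nilpotence. *)
Lemma poly_t_nilpotent : t_nilpotent_on e%:P.
Proof.
move=> f f_nil; apply: contrapT => f_prod.
(* [c] is a product of coefficients of the first [j] polynomials. *)
pose tail j c := forall N, c%:P * \prod_(j <= i < N) f i * e%:P <> 0.
have step (z : {jc : nat * P | tail jc.1 jc.2}) :
    exists i, tail (sval z).1.+1 ((sval z).2 * (f (sval z).1)`_i).
  case: z => -[j c] /= cP; apply: contrapT => no_i.
  have /choice[K KP] i : exists N, (c * (f j)`_i)%:P * \prod_(j.+1 <= k < N) f k * e%:P = 0.
    by apply: contrapT => /forallNP iP; apply: no_i; exists i.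
  pose N := maxn j.+1 (\max_(i < size (f j)) K i).
  apply: (cP N); rewrite big_ltn ?leq_max ?leqnn//.
  rewrite -[f j in LHS]coefK poly_def !(mulr_suml, mulr_sumr) big1// => i _.
  have KN : (K i <= N)%N by rewrite leq_max leq_bigmax orbT.
  have [jK|Kj] := leqP j.+1 (K i).
    rewrite (big_cat_nat jK KN) /= -mul_polyC.
    rewrite (_ : _ * e%:P = ((c * (f j)`_i)%:P * \prod_(j.+1 <= k < K i) f k * e%:P) *
      ('X^i * \prod_(K i <= k < N) f k)); last by rewrite polyCM; ring.
    by rewrite KP mul0r.
  have := KP i; rewrite big_geq ?(ltnW Kj)// mulr1 => cf0.
  rewrite -mul_polyC (_ : _ * e%:P = ((c * (f j)`_i)%:P * e%:P) *
    ('X^i * \prod_(j.+1 <= k < N) f k)); last by rewrite polyCM; ring.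
  by rewrite cf0 mul0r.
have [next nextP] := choice step.
have tail0 : tail 0%N 1.
  by move=> N; rewrite mul1r => f0; apply: f_prod; exists N.
pose z k := iter k (fun z => exist _ (_, _) (nextP z) : {jc : nat * P | tail jc.1 jc.2})
  (exist _ (0%N, 1) tail0).
have z1 k : (sval (z k)).1 = k by elim: k => //= k ->.
pose u k := (f k)`_(next (z k)).
have z2 k : (sval (z k)).2 = \prod_(0 <= i < k) u i.
  by elim: k => [|k IHk]; [rewrite big_geq|rewrite big_nat_recr//= -IHk /u z1].
have [|N uN] := e_prim.2 u.
  by move=> N; have [j [Nj fj]] := f_nil N; exists j; split=> //; exact: poly_coef_nil.
have := svalP (z N); rewrite /tail z1 z2 => /(_ N); rewrite (big_geq (leqnn N)) mulr1.
by rewrite -polyCM uN; apply.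
Qed.

Lemma poly_primary : primary e%:P.
Proof.
split; last exact: poly_t_nilpotent.
move=> f; have [/coef_poly_nil|[g [D /regular_top_regular]]] := poly_dichotomy f.
  by left.
by right.
Qed.

End PrimaryPoly.

Lemma poly_primary_ring (P : comNzRingType) : primary_ring P -> primary_ring {poly P}.
Proof.
move=> [I [e [e_orth e_sum e_prim]]]; exists I, (fun i => (e i)%:P); split.
- by move=> i j; rewrite -polyCM e_orth; case: eqP.
- by rewrite -rmorph_sum e_sum.
- by move=> i; apply: poly_primary; rewrite ?(orth_idem e_orth).
Qed.

(** On each piece [poly_dichotomy] provides a multiple with regular leading
    coefficient; shifting by powers of the variable equalizes the degrees. *)
Lemma regular_lead_coef (P : comNzRingType) (f : {poly P}) :
  primary_ring P -> GRing.lreg f -> exists g, GRing.lreg (lead_coef (f * g)).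
Proof.
move=> [I [e [e_orth e_sum e_prim]]] f_reg.
have /choice[g /choice[D gD]] i : exists g D, regular_top (e i) (f * g * (e i)%:P) D.
  have [/coef_poly_nil f_nil|//] := poly_dichotomy (orth_idem e_orth i) (e_prim i) f.
  have e0 : e i = 0.
    apply/polyC_inj/regular_on_nil/f_nil => h.
    by rewrite -mulrA; exact: lreg_eq0.
  exists 0, 0%N; rewrite mulr0 mul0r e0; split; first by rewrite size_poly0.
  by move=> h; rewrite !mulr0.
pose K := \max_i D i.
pose G := \sum_i g i * (e i)%:P * 'X^(K - D i).
have fG j : (f * G)`_j = \sum_i
    (if (j < K - D i)%N then 0 else (f * g i * (e i)%:P)`_(j - (K - D i))).
  rewrite mulr_sumr coef_sum; apply: eq_bigr => i _.
  by rewrite !mulrA coefMXn.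
have DK i : (D i <= K)%N by exact: leq_bigmax.
have sK : (size (f * G)%R <= K.+1)%N.
  apply/leq_sizeP => j Kj; rewrite fG big1// => i _.
  rewrite ltnNge (leq_trans (leq_subr _ _) (ltnW Kj)) /= nth_default//.
  by rewrite (leq_trans (gD i).1)// ltn_subRL subnK// .
have top : GRing.lreg (f * G)`_K.
  rewrite fG (_ : \sum_i _ = \sum_i (f * g i)`_(D i) * e i); last first.
    apply: eq_bigr => i _; rewrite ltnNge leq_subr /= subKn//.
    by rewrite coefMC.
  apply: lreg_sum => // i h; have := (gD i).2 h.
  by rewrite coefMC [_ * e i * h]mulrAC -(mulrA _ (e i) (e i)) (orth_idem e_orth).
exists G; suff -> : lead_coef (f * G) = (f * G)`_K by [].
rewrite lead_coefE; suff -> : size (f * G)%R = K.+1 by [].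
apply/eqP; rewrite eqn_leq sK /= ltnNge; apply/negP => /leq_sizeP/(_ K (leqnn _)) K0.
by move: top; rewrite K0 => /lreg_eq0 /(_ (mul0r 1)) /eqP; rewrite oner_eq0.
Qed.

(** * Finite projective algebras *)

Section PolyEval.
Variables (P : comNzRingType) (A : comPzRingType) (phi : {rmorphism P -> A}) (y : A).

(** Evaluation at a point of an algebra whose structure map is [phi]; the algebra
    may be the zero ring. *)
Definition poly_eval (p : {poly P}) : A := \sum_(i < size p) phi p`_i * y ^+ i.

Lemma poly_eval_wide n (p : {poly P}) : (size p <= n)%N ->
  poly_eval p = \sum_(i < n) phi p`_i * y ^+ i.
Proof.
move=> pn; rewrite /poly_eval -!(big_mkord predT (fun i => phi p`_i * y ^+ i)).
rewrite (big_cat_nat (leq0n _) pn) /= [X in _ + X]big_nat_cond [X in _ + X]big1 ?addr0//.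
by move=> i /andP[/andP[pi _] _]; rewrite nth_default// rmorph0 mul0r.
Qed.

Lemma poly_evalD p q : poly_eval (p + q) = poly_eval p + poly_eval q.
Proof.
pose n := maxn (size p) (size q).
rewrite !(@poly_eval_wide n) ?leq_maxl ?leq_maxr ?size_polyD// -big_split.
by apply: eq_bigr => i _; rewrite /= coefD rmorphD mulrDl.
Qed.

Lemma poly_evalC c : poly_eval c%:P = phi c.
Proof.
by rewrite (@poly_eval_wide 1) ?size_polyC_leq1// big_ord1 expr0 mulr1 coefC.
Qed.

Lemma poly_eval0 : poly_eval 0 = 0.
Proof. by rewrite -polyC0 poly_evalC rmorph0. Qed.

Lemma poly_evalMX p : poly_eval (p * 'X) = poly_eval p * y.
Proof.
have s : (size (p * 'X)%R <= (size p).+1)%N.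
  by rewrite (leq_trans (size_polyMleq _ _))// size_polyX addn2.
rewrite (poly_eval_wide s) big_ord_recl coefMX rmorph0 mul0r add0r mulr_suml.
by apply: eq_bigr => i _; rewrite coefMX /= exprSr mulrA.
Qed.

Lemma poly_evalCM c p : poly_eval (c%:P * p) = phi c * poly_eval p.
Proof.
have s : (size (c%:P * p)%R <= size p)%N by rewrite mul_polyC size_scale_leq.
rewrite (poly_eval_wide s) mulr_sumr.
by apply: eq_bigr => i _; rewrite coefCM rmorphM mulrA.
Qed.

Lemma poly_eval_zmod : zmod_morphism poly_eval.
Proof.
by move=> p q; apply/eqP; rewrite eq_sym subr_eq eq_sym -poly_evalD subrK.
Qed.

Lemma poly_eval_monoid : monoid_morphism poly_eval.
Proof.
split; first by rewrite -polyC1 poly_evalC rmorph1.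
move=> p q; elim/poly_ind: p => [|p c IHp]; first by rewrite mul0r poly_eval0 mul0r.
rewrite mulrDl !poly_evalD poly_evalCM -mulrA [_ * q]mulrC mulrA poly_evalMX.
by rewrite IHp poly_evalMX poly_evalC; ring.
Qed.

HB.instance Definition _ :=
  GRing.isZmodMorphism.Build {poly P} A poly_eval poly_eval_zmod.
HB.instance Definition _ :=
  GRing.isMonoidMorphism.Build {poly P} A poly_eval poly_eval_monoid.

Lemma poly_evalX : poly_eval 'X = y.
Proof. by rewrite -['X]mul1r poly_evalMX rmorph1 mul1r. Qed.

End PolyEval.

(** [A], as a module over [P] by means of [phi], is finitely generated and
    projective: [x] and [lam] are a finite dual basis. Only the operations of [A]
    are used, so no module structure has to be put on quotients of [A]. *)
Definition finite_projective (P A : comPzRingType) (phi : {rmorphism P -> A}) : Prop :=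
  exists r (x : 'I_r -> A) (lam : 'I_r -> A -> P),
    (forall i p a b, lam i (phi p * a + b) = p * lam i a + lam i b) /\
    (forall a, a = \sum_i phi (lam i a) * x i).

Lemma finite_projectiveI (P A : comPzRingType) (phi : {rmorphism P -> A})
    (I : finType) (x : I -> A) (lam : I -> A -> P) :
    (forall i p a b, lam i (phi p * a + b) = p * lam i a + lam i b) ->
    (forall a, a = \sum_i phi (lam i a) * x i) ->
  finite_projective phi.
Proof.
move=> lam_lin x_gen; exists #|I|, (x \o enum_val), (fun j => lam (enum_val j)).
by split=> // a; rewrite [LHS]x_gen (reindex (fun j : 'I_#|I| => enum_val j))//;
  exact/onW_bij/enum_val_bij.
Qed.

Section FiniteProjective.
Variables (P A : comPzRingType) (phi : {rmorphism P -> A}).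
Variables (r : nat) (x : 'I_r -> A) (lam : 'I_r -> A -> P).
Hypothesis lam_lin : forall i p a b, lam i (phi p * a + b) = p * lam i a + lam i b.
Hypothesis x_gen : forall a, a = \sum_i phi (lam i a) * x i.

Lemma coordD i a b : lam i (a + b) = lam i a + lam i b.
Proof. by rewrite -[a in LHS]mul1r -(rmorph1 phi) lam_lin mul1r. Qed.

Lemma coord0 i : lam i 0 = 0.
Proof. by apply: (addrI (lam i 0)); rewrite -coordD !addr0. Qed.

Lemma coordZ i p a : lam i (phi p * a) = p * lam i a.
Proof. by rewrite -[phi p * a]addr0 lam_lin coord0 addr0. Qed.

Lemma coord_sum i I (s : seq I) (Q : pred I) (F : I -> A) :
  lam i (\sum_(j <- s | Q j) F j) = \sum_(j <- s | Q j) lam i (F j).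
Proof. exact: (big_morph _ (coordD i) (coord0 i)). Qed.

Lemma coord_inj a : (forall i, lam i a = 0) -> a = 0.
Proof. by move=> a0; rewrite [a]x_gen big1// => i _; rewrite a0 rmorph0 mul0r. Qed.

(** The matrix of multiplication by [a] with respect to the generators [x]. When
    they are not a basis, [mul_matrix 1] is only an idempotent matrix, but
    [recombine] still intertwines [mul_matrix a] with multiplication by [a]. *)
Definition mul_matrix (a : A) : 'M[P]_r := \matrix_(i, j) lam i (a * x j).
Definition recombine (w : 'cV[P]_r) : A := \sum_i phi (w i 0) * x i.

Lemma recombine_mul a w : recombine (mul_matrix a *m w) = a * recombine w.
Proof.
rewrite [RHS]x_gen; apply: eq_bigr => i _; congr (phi _ * _).
rewrite mxE mulr_sumr coord_sum; apply: eq_bigr => j _.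
by rewrite mulrCA coordZ mxE mulrC.
Qed.

Lemma recombine_prod (a : nat -> A) N w :
  recombine ((\prod_(0 <= i < N) mul_matrix (a i)) *m w) =
  (\prod_(0 <= i < N) a i) * recombine w.
Proof.
elim: N w => [|N IHN] w; first by rewrite !big_geq// mul1mx mul1r.
by rewrite !big_nat_recr//= -mulmxA IHN recombine_mul mulrA.
Qed.

Lemma recombineZ p w : recombine (p *: w) = phi p * recombine w.
Proof.
by rewrite /recombine mulr_sumr; apply: eq_bigr => i _; rewrite mxE rmorphM mulrA.
Qed.

Lemma recombine_coord a : recombine (\col_i lam i a) = a.
Proof. by rewrite [RHS]x_gen; apply: eq_bigr => i _; rewrite mxE. Qed.

End FiniteProjective.

(** Coordinates are linear and determine the element. *)
Lemma finite_projective_regular (P A : comPzRingType) (phi : {rmorphism P -> A}) f :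
  finite_projective phi -> GRing.lreg f -> GRing.lreg (phi f).
Proof.
move=> [r [x [lam [lam_lin x_gen]]]] freg; apply: lregI => a fa.
apply: (coord_inj x_gen) => i; apply: (lreg_eq0 freg).
by rewrite -(coordZ lam_lin) fa (coord0 lam_lin).
Qed.

(** The theorem of Cayley and Hamilton for the matrix of multiplication by [a],
    transposed because the generators form a column vector. *)
Lemma finite_projective_integral (P : comNzRingType) (A : comPzRingType)
    (phi : {rmorphism P -> A}) (a : A) : finite_projective phi ->
  exists p : {poly P}, p \is monic /\ poly_eval phi a p = 0.
Proof.
move=> [r [x [lam [lam_lin x_gen]]]]; pose M := mul_matrix x lam a.
exists (char_poly M^T); split; first exact: char_poly_monic.
set d := poly_eval _ _ _.
suff dx i : d * x i = 0.
  rewrite -[d]mulr1 [1]x_gen mulr_sumr big1// => i _.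
  by rewrite mulrCA dx mulr0.
pose X : 'cV[A]_r := \col_i x i.
pose B := map_mx (poly_eval phi a) (char_poly_mx M^T).
have BX : B *m X = 0.
  apply/colP => k; rewrite !mxE; under eq_bigr => j _.
    rewrite !mxE -[poly_eval _ _ _]/(poly_eval phi a _) rmorphB /= poly_evalC.
    rewrite rmorphMn /= poly_evalX mulrBl; over.
  rewrite sumrB (bigD1 k)//= eqxx mulr1n big1 ?addr0.
    by rewrite {1}[a * x k]x_gen subrr.
  by move=> j /negPf kj; rewrite eq_sym kj mulr0n mul0r.
have /colP/(_ i) : d%:M *m X = 0.
  by rewrite /d /char_poly -det_map_mx -mul_adj_mx -mulmxA BX mulmx0.
by rewrite mul_scalar_mx !mxE.
Qed.

Section RegularNorm.
Variables (P : comNzRingType) (A : comPzRingType) (phi : {rmorphism P -> A}) (a : A).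
Hypothesis a_reg : GRing.lreg a.

(** Descent along the coefficients of a monic polynomial [p] whose value at [a] is
    nilpotent on [e]. If the constant coefficient [c] is regular on [e], a power
    of it is a multiple of [a]. If [c] is nilpotent on [e], then [a] times the
    value of the shorter polynomial is nilpotent, and [a] can be cancelled. *)
Lemma norm_on e (p : {poly P}) : primary e -> p \is monic ->
    nil_on (phi e) (poly_eval phi a p) ->
  exists g b, phi (g * e) = a * b /\ regular_on e g.
Proof.
move=> e_prim; elim/poly_ind: p => [|p c IHp]; first by rewrite monicE lead_coef0 eq_sym oner_eq0.
rewrite poly_evalD poly_evalMX poly_evalC => p_monic p_nil.
have [c_nil|c_reg] := e_prim.1 c; last first.
  have [k pk] := p_nil; exists (c ^+ k).
  have := subrXX (phi c) (poly_eval phi a p * a + phi c) k.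
  move: (\sum_(i < k) _) => s cs.
  exists (- (poly_eval phi a p * s * phi e)); split; last exact: regular_onX.
  rewrite rmorphM rmorphXn /= -[_ ^+ k](subrK ((poly_eval phi a p * a + phi c) ^+ k)).
  by rewrite mulrDl pk addr0 cs; ring.
have [p0|p0] := eqVneq p 0.
  move: p_monic p_nil; rewrite p0 mul0r add0r poly_eval0 mul0r add0r.
  rewrite monicE lead_coefC => /eqP->; rewrite rmorph1 => -[k].
  rewrite expr1n mul1r => e0; exists 1, 0; rewrite mul1r e0 mulr0; split=> // h.
  by rewrite mul1r.
apply: IHp.
  move: p_monic; rewrite !monicE lead_coefDl ?lead_coefMX//.
  by rewrite size_mulX// (leq_ltn_trans (size_polyC_leq1 _))// ltnS size_poly_gt0.
have [k ek] : nil_on (phi e) (poly_eval phi a p * a).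
  rewrite -[_ * a](addrK (phi c)); apply: nil_onB => //.
  by have [k ck] := c_nil; exists k; rewrite -rmorphXn -rmorphM ck rmorph0.
exists k; apply: (lreg_eq0 (lregX (n := k) a_reg)); rewrite -ek exprMn.
by ring.
Qed.

Lemma regular_multiple : primary_ring P -> finite_projective phi ->
  exists f b, GRing.lreg f /\ phi f = a * b.
Proof.
move=> [I [e [e_orth e_sum e_prim]]] /(finite_projective_integral a)[p [p_monic p0]].
have /choice[g /choice[b gb]] i : exists g b, phi (g * e i) = a * b /\ regular_on (e i) g.
  by apply: (norm_on (e_prim i) p_monic); rewrite p0; exact: nil_on0.
exists (\sum_i g i * e i), (\sum_i b i); split.
  by apply: lreg_sum => // i; exact: (gb i).2.
by rewrite rmorph_sum mulr_sumr; apply: eq_bigr => i _; exact: (gb i).1.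
Qed.

End RegularNorm.

Lemma matrix_common_denominator (P : comPzRingType) m n (X : 'M[total_quotient P]_(m, n)) :
  exists t (Y : 'M[P]_(m, n)), GRing.lreg t /\
    to_quotient t *: X = map_mx (@to_quotient P) Y.
Proof.
have /choice[a /choice[s asP]] (z : 'I_m * 'I_n) := quotient_fraction (X z.1 z.2).
exists (\prod_z s z), (\matrix_(i, j) (a (i, j) * \prod_(z | z != (i, j)) s z)); split.
  by apply: lreg_prod => z _; exact: (asP z).1.
apply/matrixP => i j; rewrite !mxE (bigD1 (i, j))//= !rmorphM /=.
by rewrite -(asP (i, j)).2 /=; ring.
Qed.

(** The matrices of multiplication by the members of a sequence satisfy the chain
    condition over the total quotient ring of [P] by [perfect_matrix_dcc]; after
    clearing denominators, applying the matrix identity to the coordinates of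
    [1] gives the chain condition for the members themselves. *)
Theorem finite_projective_dcc (P A : comPzRingType) (phi : {rmorphism P -> A}) :
  primary_ring P -> finite_projective phi -> regular_dcc A.
Proof.
move=> Pprim phi_fp a.
have Qperf : perfect (total_quotient P).
  exact/dcc_perfect/regular_dcc_quotient/primary_regular_dcc.
have [r [x [lam [lam_lin x_gen]]]] := phi_fp.
pose M i := mul_matrix x lam (a i).
have map_prod k : \prod_(0 <= i < k) map_mx (@to_quotient P) (M i) =
    map_mx (@to_quotient P) (\prod_(0 <= i < k) M i).
  elim: k => [|k IHk]; first by rewrite !big_geq// map_mx1.
  by rewrite !big_nat_recr//= IHk map_mxM.
have [N NP] := perfect_matrix_dcc (fun i => map_mx (@to_quotient P) (M i)) Qperf.
exists N => k; have [X] := NP k; rewrite !map_prod => NX.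
have [t [Y [t_reg tX]]] := matrix_common_denominator X.
have {NX tX} NY : t *: \prod_(0 <= i < N) M i = (\prod_(0 <= i < k) M i) *m Y.
  have /matrixP MN : map_mx (@to_quotient P) (t *: \prod_(0 <= i < N) M i) =
      map_mx (@to_quotient P) ((\prod_(0 <= i < k) M i) *m Y).
    by rewrite map_mxZ map_mxM NX -tX scalemxAr.
  apply/matrixP => i j; apply: to_quotient_inj.
  by have := MN i j; rewrite [LHS]mxE [RHS]mxE.
pose v := \col_i lam i 1.
exists (phi t), (recombine phi x (Y *m v)); split.
  exact: (finite_projective_regular phi_fp).
have := congr1 (fun B => recombine phi x (B *m v)) NY.
rewrite /= -scalemxAl recombineZ -mulmxA !(recombine_prod lam_lin x_gen).
by rewrite (recombine_coord x_gen) mulr1 => ->; rewrite mulrC.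
Qed.

Section QuotientByMultiple.
Variables (P : comNzRingType) (A C : comPzRingType) (phi : {rmorphism {poly P} -> A}).
Variables (pi : {rmorphism A -> C}) (a b : A) (f : {poly P}).
Hypothesis f_monic : f \is monic.
Hypothesis phi_f : phi f = a * b.
Hypothesis pi_surj : forall c, exists u, pi u = c.
Hypothesis pi_ker : forall u, pi u = 0 <-> exists v, u = a * v.

Let rdivp_unique (q r : {poly P}) : (size r < size f)%N -> rdivp (q * f + r) f = q.
Proof. by move=> rf; rewrite /rdivp redivp_eq. Qed.

Let rdivmod_linear c p q : rdivp (c%:P * p + q) f = c%:P * rdivp p f + rdivp q f /\
  rmodp (c%:P * p + q) f = c%:P * rmodp p f + rmodp q f.
Proof.
have f0 : f != 0 by exact: monic_neq0.
have -> : c%:P * p + q = (c%:P * rdivp p f + rdivp q f) * f + (c%:P * rmodp p f + rmodp q f).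
  by rewrite {1}(rdivp_eq f_monic p) {1}(rdivp_eq f_monic q); ring.
have s : (size (c%:P * rmodp p f + rmodp q f)%R < size f)%N.
  rewrite (leq_ltn_trans (size_polyD _ _))// gtn_max ltn_rmodp f0 andbT.
  by rewrite mul_polyC (leq_ltn_trans (size_scale_leq _ _))// ltn_rmodp.
by split; [exact: rdivp_unique|exact: rmodp_addl_mul_small].
Qed.

(** The map [q], division by [f] on coordinates, is [P]-linear and
    [q (phi f * u) = u]. Since [phi f = a * b], the map [sigma] is a [P]-linear
    projection that kills [a * A] and differs from the identity by multiples of
    [a]; it induces a section of [pi]. Coordinates of [sigma u] may be reduced
    modulo [f], which leaves finitely many coefficients. *)
Theorem finite_projective_quotient : finite_projective phi ->
  finite_projective (pi \o phi \o polyC : {rmorphism P -> C}).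
Proof.
move=> [r [x [lam [lam_lin x_gen]]]].
pose q u := \sum_i phi (rdivp (lam i u) f) * x i.
have q_lin c u v : q (phi c%:P * u + v) = phi c%:P * q u + q v.
  rewrite /q mulr_sumr -big_split; apply: eq_bigr => i _ /=.
  by rewrite lam_lin (rdivmod_linear _ _ _).1 rmorphD rmorphM mulrDl mulrA.
have q_f u : q (phi f * u) = u.
  rewrite [RHS]x_gen; apply: eq_bigr => i _; rewrite (coordZ lam_lin); congr (phi _ * _).
  rewrite mulrC -[_ * f]addr0 rdivp_unique// size_poly0 size_poly_gt0.
  exact: monic_neq0.
pose sigma u := u - a * q (b * u).
have sigma_lin c u v : sigma (phi c%:P * u + v) = phi c%:P * sigma u + sigma v.
  by rewrite /sigma mulrDr mulrCA q_lin; ring.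
have sigma_a u : sigma (a * u) = 0.
  by rewrite /sigma mulrA [b * a]mulrC -phi_f q_f subrr.
have sigma_pi u v : pi u = pi v -> sigma u = sigma v.
  move/eqP; rewrite -subr_eq0 -rmorphB => /eqP/pi_ker[w uv].
  by rewrite -[u](subrK v) uv -[a * w]mul1r -(rmorph1 phi) sigma_lin sigma_a mulr0 add0r.
have [lift liftK] := choice pi_surj.
apply: (@finite_projectiveI _ _ _ ('I_r * 'I_(size f))%type
  (fun z => pi (phi 'X^(z.2) * x z.1))
  (fun z c => (rmodp (lam z.1 (sigma (lift c))) f)`_(z.2))).
  move=> [i j] c u v /=.
  rewrite (sigma_pi _ (phi c%:P * lift u + lift v)); last first.
    by rewrite liftK rmorphD rmorphM /= !liftK.
  by rewrite sigma_lin lam_lin (rdivmod_linear _ _ _).2 coefD coefCM.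
move=> c; rewrite -(pair_bigA _ (fun i (j : 'I_(size f)) =>
  pi (phi ((rmodp (lam i (sigma (lift c))) f)`_j)%:P) *
  pi (phi 'X^j * x i))) /=.
have pi_a u : pi (a * u) = 0 by apply/pi_ker; exists u.
transitivity (pi (sigma (lift c))).
  by rewrite rmorphB pi_a subr0 liftK.
rewrite {1}[sigma (lift c)]x_gen rmorph_sum; apply: eq_bigr => i _ /=.
set p := lam i _.
have -> : pi (phi p * x i) = pi (phi (rmodp p f) * x i).
  have -> : phi p = phi (rdivp p f) * (a * b) + phi (rmodp p f).
    by rewrite -phi_f -rmorphM -rmorphD -rdivp_eq.
  rewrite mulrDl (_ : _ * _ * _ = a * (phi (rdivp p f) * b * x i)); last by ring.
  by rewrite rmorphD pi_a add0r.
have {1}-> : rmodp p f = \sum_(j < size f) ((rmodp p f)`_j)%:P * 'X^j.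
  rewrite -[LHS]coefK poly_def.
  under [RHS]eq_bigr => j _ do rewrite mul_polyC.
  rewrite -!(big_mkord predT (fun j => (rmodp p f)`_j *: 'X^j)).
  have pf : (size (rmodp p f) <= size f)%N by rewrite ltnW// ltn_rmodpN0// monic_neq0.
  rewrite (big_cat_nat (leq0n _) pf) /= [X in _ + X]big_nat_cond.
  rewrite [X in _ + X]big1 ?addr0// => j /andP[/andP[pj _] _].
  by rewrite nth_default// scale0r.
rewrite rmorph_sum mulr_suml rmorph_sum; apply: eq_bigr => j _ /=.
by rewrite -[RHS]rmorphM (rmorphM phi) mulrA.
Qed.

End QuotientByMultiple.

(** * Normalization of regular polynomials *)

(** After a suitable automorphism, each regular polynomial divides a monic one. *)
Definition normalizable (P : comNzRingType) : Prop :=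
  forall f : {poly P}, GRing.lreg f ->
  exists th th' : {rmorphism {poly P} -> {poly P}},
    [/\ cancel th th', cancel th' th & exists g, th f * g \is monic].

Lemma dcc_normalizable (R : comNzRingType) : principal_dcc R -> normalizable R.
Proof.
move=> Rdcc f freg.
have [g /(dcc_regular_unit Rdcc)[c cg]] := regular_lead_coef (dcc_primary_ring Rdcc) freg.
exists idfun, idfun; split=> //; exists (g * c%:P).
have gc : lead_coef (f * g) * lead_coef c%:P = 1 by rewrite lead_coefC mulrC.
by rewrite mulrA monicE lead_coef_proper_mul gc ?oner_eq0.
Qed.

Section Shear.
Variable Q : comNzRingType.

(** The substitution of [t + u ^+ k] for the outer variable [t], where [u] is the
    inner one, followed by the exchange of the two variables. *)
Definition shear (k : nat) (h : {poly {poly Q}}) : {poly {poly Q}} :=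
  swapXY (h \Po ('X + ('X^k)%:P)).

(** For large [k] the powers of [u] coming from the leading term in [t] dominate
    all others. *)
Lemma shear_monic (h : {poly {poly Q}}) : lead_coef h \is monic ->
  exists k, shear k h \is monic.
Proof.
move=> h_monic.
have h0 : h != 0.
  by apply: contraTneq h_monic => ->; rewrite lead_coef0 monicE lead_coef0 eq_sym oner_eq0.
have [n hn] : exists n, size h = n.+1 by exists (size h).-1; rewrite prednK// size_poly_gt0.
(* Large enough for the lower terms in [t] to have smaller degree in [u]. *)
pose k := (\max_(j < n) size (h`_j)%R).+1; exists k.
pose y : {poly {poly Q}} := 'X^k + 'X%:P.
have sY : (size ('X%:P : {poly {poly Q}}) < size ('X^k : {poly {poly Q}})%R)%N.
  by rewrite size_polyXn ltnS (leq_trans (size_polyC_leq1 _)).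
have y_monic : y \is monic by rewrite monicE lead_coefDl// lead_coefXn.
have sy : size y = k.+1 by rewrite size_polyDl// size_polyXn.
have yX j : y ^+ j \is monic by exact: monic_exp.
have syX j : size (y ^+ j)%R = (k * j).+1.
  elim: j => [|j IHj]; first by rewrite muln0 expr0 size_poly1.
  by rewrite exprS size_monicM ?monic_neq0// IHj sy mulnS addSn addnS.
have -> : shear k h = \sum_(j < n.+1) (map_poly polyC (h`_j)) * y ^+ j.
  rewrite /shear comp_polyE hn rmorph_sum; apply: eq_bigr => j _.
  rewrite -mul_polyC rmorphM rmorphXn rmorphD /= swapXY_X !swapXY_polyC.
  by rewrite map_polyXn [y]addrC.
rewrite big_ord_recr /=.
have top_monic : map_poly polyC (h`_n) \is monic.
  move: h_monic; rewrite lead_coefE hn /= => /monicP hn1.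
  by rewrite monicE lead_coef_map_inj ?hn1//; exact: polyC_inj.
rewrite addrC monicE lead_coefDl; first by rewrite lead_coef_Mmonic// -monicE.
rewrite (size_monicM top_monic (monic_neq0 (yX n))) syX addnS /=.
have s0 : (0 < size (map_poly polyC (h`_n) : {poly {poly Q}}))%N.
  by rewrite size_poly_gt0 monic_neq0.
apply: (@leq_ltn_trans (k * n)%N); last by rewrite -[X in (X < _)%N]add0n ltn_add2r.
apply: (leq_trans (size_sum _ _ _)); apply/bigmax_leqP => j _.
apply: (leq_trans (size_polyMleq _ _)); rewrite syX addnS /=.
apply: (@leq_trans (k + k * j)%N); last by rewrite -mulnS leq_mul.
rewrite leq_add2r (leq_trans (size_poly _ _))// ltnW// ltnS.
exact: (leq_bigmax j).
Qed.

End Shear.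

(** First make the leading coefficient regular by [regular_lead_coef], then monic
    in the inner variable by the hypothesis on [Q], and finally shear. *)
Lemma poly_normalizable (Q : comNzRingType) :
  primary_ring {poly Q} -> normalizable Q -> normalizable {poly Q}.
Proof.
move=> Qprim Qnorm f freg.
have [g1 /Qnorm[th [th' [thK th'K [g2 g2_monic]]]]] := regular_lead_coef Qprim freg.
pose h := map_poly th (f * g1) * g2%:P.
have h_lead : lead_coef h = th (lead_coef (f * g1)) * g2.
  have lead_map : lead_coef (map_poly th (f * g1)) = th (lead_coef (f * g1)).
    by rewrite lead_coef_map_inj ?rmorph0//; exact: can_inj thK.
  have := @lead_coef_proper_mul _ (map_poly th (f * g1)) g2%:P.
  by rewrite /= lead_map lead_coefC; apply; exact: monic_neq0.
have [k k_monic] : exists k, shear k h \is monic by apply: shear_monic; rewrite h_lead.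
pose y : {poly {poly Q}} := ('X^k)%:P.
exists (@swapXY Q \o comp_poly ('X + y) \o map_poly th).
exists (map_poly th' \o comp_poly ('X - y) \o @swapXY Q); split.
- move=> p /=; rewrite swapXYK -comp_polyA comp_polyD comp_polyX comp_polyC subrK comp_polyXr.
  by rewrite -map_poly_comp map_poly_id// => c _ /=; rewrite thK.
- move=> p /=; rewrite -map_poly_comp map_poly_id; last by move=> c _ /=; rewrite th'K.
  by rewrite -comp_polyA comp_polyB comp_polyX comp_polyC addrK comp_polyXr swapXYK.
- exists (swapXY ((map_poly th g1 * g2%:P) \Po ('X + y))).
  rewrite /= -rmorphM -(rmorphM (comp_poly _)) mulrA -rmorphM.
  exact: k_monic.
Qed.

(** Variables are adjoined one at a time, so that the last one can be singled
    out; it plays the role of [t] above. *)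
Fixpoint iterated_poly (R : comNzRingType) (m : nat) : comNzRingType :=
  if m is m'.+1 then {poly iterated_poly R m'} else R.

Lemma iterated_poly_primary (R : comNzRingType) m :
  principal_dcc R -> primary_ring (iterated_poly R m).
Proof.
move=> Rdcc; elim: m => [|m IHm]; first exact: dcc_primary_ring.
exact: poly_primary_ring.
Qed.

Lemma iterated_poly_normalizable (R : comNzRingType) m :
  principal_dcc R -> normalizable (iterated_poly R m).
Proof.
move=> Rdcc; elim: m => [|m IHm]; first exact: dcc_normalizable.
by apply: poly_normalizable => //; exact: (@iterated_poly_primary _ m.+1).
Qed.

Lemma finite_projective_automorphism (P A : comPzRingType) (phi : {rmorphism P -> A})
    (th th' : {rmorphism P -> P}) : cancel th th' -> cancel th' th ->
  finite_projective phi -> finite_projective (phi \o th' : {rmorphism P -> A}).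
Proof.
move=> thK th'K [r [x [lam [lam_lin x_gen]]]]; exists r, x, (fun i a => th (lam i a)).
split=> [i p a b|a] /=; first by rewrite lam_lin rmorphD rmorphM th'K.
by rewrite [LHS]x_gen; apply: eq_bigr => i _; rewrite thK.
Qed.

Lemma finite_projective_regular_quotient (P : comNzRingType) (A C : comPzRingType)
    (phi : {rmorphism {poly P} -> A}) (pi : {rmorphism A -> C}) (a : A) :
    primary_ring {poly P} -> normalizable P -> finite_projective phi ->
    GRing.lreg a -> (forall c, exists u, pi u = c) ->
    (forall u, pi u = 0 <-> exists v, u = a * v) ->
  exists psi : {rmorphism P -> C}, finite_projective psi.
Proof.
move=> Pprim Pnorm phi_fp a_reg pi_surj pi_ker.
have [f [b [/Pnorm[th [th' [thK th'K [g g_monic]]]] fE]]] := regular_multiple a_reg Pprim phi_fp.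
have phi_f : (phi \o th') (th f * g) = a * (b * phi (th' g)).
  by rewrite /= rmorphM thK rmorphM fE mulrA.
exists (pi \o (phi \o th') \o polyC).
apply: (finite_projective_quotient g_monic phi_f pi_surj pi_ker).
exact: finite_projective_automorphism phi_fp.
Qed.

Lemma regular_coef0 (P : comNzRingType) (g : {poly P}) : g`_0 = 1 -> GRing.lreg g.
Proof.
move=> g0; apply: lregI => h gh; apply/polyP => n; rewrite coef0.
elim/ltn_ind: n => n IHn; have := congr1 (fun p : {poly P} => p`_n) gh.
rewrite /= coefM coef0 big_ord_recl /= g0 mul1r subn0 big1 ?addr0// => i _.
by rewrite IHn ?mulr0// ltn_subrL (leq_trans _ (ltn_ord i))//.
Qed.

(** Multiplying an integral equation of degree [n] for an inverse [b] of the
    variable by the [n]-th power of the variable shows that the image of a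
    polynomial with constant term [1] vanishes. *)
Lemma variable_nonunit (P : comNzRingType) (A : comPzRingType)
    (phi : {rmorphism {poly P} -> A}) (b : A) :
  finite_projective phi -> phi 'X * b = 1 -> 1 = 0 :> A.
Proof.
move=> phi_fp Xb; have [p [p_monic p0]] := finite_projective_integral b phi_fp.
have [n pn] : exists n, size p = n.+1.
  by exists (size p).-1; rewrite prednK// size_poly_gt0 monic_neq0.
(* The reversed polynomial has constant term [1] because [p] is monic. *)
pose g := \sum_(i < n.+1) p`_i * 'X^(n - i).
have g_reg : GRing.lreg (phi g).
  apply: finite_projective_regular => //; apply: regular_coef0.
  rewrite /g coef_sum big_ord_recr /= subnn mulr1 big1 ?add0r.
    by have /monicP := p_monic; rewrite lead_coefE pn /= => ->; rewrite coef1.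
  by move=> i _; rewrite coefMXn subn_gt0 ltn_ord.
apply: (lreg_eq0 g_reg); rewrite mulr1 /g rmorph_sum.
transitivity (phi 'X ^+ n * poly_eval phi b p); last by rewrite p0 mulr0.
rewrite (@poly_eval_wide _ _ _ _ n.+1) ?pn// mulr_sumr.
apply: eq_bigr => i _; rewrite rmorphM rmorphXn mulrCA; congr (_ * _).
have -> : phi 'X ^+ n = phi 'X ^+ (n - i) * phi 'X ^+ i by rewrite -exprD subnK// -ltnS.
by rewrite -mulrA -exprMn Xb expr1n mulr1.
Qed.

Lemma regular_unit_over_dcc (R : comNzRingType) (A : comPzRingType)
    (phi : {rmorphism R -> A}) (a : A) :
  principal_dcc R -> finite_projective phi -> GRing.lreg a -> exists b, a * b = 1.
Proof.
move=> Rdcc phi_fp a_reg.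
have [f [b [/(dcc_regular_unit Rdcc)[c cf] fE]]] :=
  regular_multiple a_reg (dcc_primary_ring Rdcc) phi_fp.
by exists (b * phi c); rewrite mulrA -fE mulrC -rmorphM cf rmorph1.
Qed.

(** * The Veronese subring as a finite projective algebra *)

Section IteratedEval.
Variables (R : comNzRingType) (A : comPzRingType) (c : {rmorphism R -> A}) (y : nat -> A).

Fixpoint iterated_eval (m : nat) : {rmorphism iterated_poly R m -> A} :=
  match m return {rmorphism iterated_poly R m -> A} with
  | 0 => c
  | m'.+1 => poly_eval (iterated_eval m') (y m')
  end.

Fixpoint iterated_const (m : nat) : {rmorphism R -> iterated_poly R m} :=
  match m return {rmorphism R -> iterated_poly R m} with
  | 0 => idfun
  | m'.+1 => polyC \o iterated_const m'
  end.

Fixpoint iterated_var (m i : nat) : iterated_poly R m :=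
  match m return iterated_poly R m with
  | 0 => 0
  | m'.+1 => if i == m' then 'X else (iterated_var m' i)%:P
  end.

Lemma iterated_eval_const m a : iterated_eval m (iterated_const m a) = c a.
Proof. by elim: m => //= m IHm; rewrite poly_evalC IHm. Qed.

Lemma iterated_eval_var m i : (i < m)%N -> iterated_eval m (iterated_var m i) = y i.
Proof.
elim: m => //= m IHm; rewrite ltnS leq_eqVlt; case: eqP => [->|_] /=.
  by rewrite poly_evalX.
by rewrite poly_evalC => /IHm.
Qed.

Lemma iterated_poly_ind m (K : iterated_poly R m -> Prop) :
    (forall a, K (iterated_const m a)) ->
    (forall i, (i < m)%N -> K (iterated_var m i)) ->
    (forall p q, K p -> K q -> K (p + q)) ->
    (forall p q, K p -> K q -> K (p * q)) ->
  forall p, K p.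
Proof.
elim: m K => [|m IHm] K Kc Kv KD KM; first exact: Kc.
have KC (p : iterated_poly R m) : K p%:P.
  move: p; apply: IHm => [a|i im|p q Kp Kq|p q Kp Kq].
  - exact: Kc.
  - by have := Kv i (ltnW im); rewrite /= ltn_eqF.
  - by rewrite polyCD; exact: KD.
  - by rewrite polyCM; exact: KM.
have KX : K ('X : {poly iterated_poly R m}) by have := Kv m (leqnn _); rewrite /= eqxx.
move=> p; rewrite -[p]/(p : {poly iterated_poly R m}).
elim/poly_ind: p => [|p a Kp]; first exact: (KC 0).
by apply: KD => //; exact: KM.
Qed.

End IteratedEval.

Section MonomialSum.
Variables (R : comNzRingType) (n : nat) (P : comNzRingType) (kappa : {rmorphism R -> P}).
Variable g : 'X_{1..n} -> P.

(** The linear extension to polynomials of a function [g] on monomials. *)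
Definition monomial_sum (p : {mpoly R[n]}) : P :=
  \sum_(m <- msupp p) kappa p@_m * g m.

Lemma monomial_sum_wide (s : seq 'X_{1..n}) p : uniq s -> {subset msupp p <= s} ->
  monomial_sum p = \sum_(m <- s) kappa p@_m * g m.
Proof.
move=> s_uniq ps; rewrite [RHS](bigID (mem (msupp p))) /= [X in _ + X]big1 ?addr0.
  rewrite -big_filter; apply: perm_big; apply: uniq_perm.
  - exact: msupp_uniq.
  - exact: filter_uniq.
  - by move=> m; rewrite mem_filter; case: (boolP (m \in _)) => // /ps ->.
by move=> m /memN_msupp_eq0 ->; rewrite rmorph0 mul0r.
Qed.

Lemma monomial_sum_linear a p q :
  monomial_sum (a *: p + q) = kappa a * monomial_sum p + monomial_sum q.
Proof.
(* The three sums are compared on a common support. *)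
pose s := undup (msupp p ++ msupp q ++ msupp (a *: p + q)).
rewrite !(@monomial_sum_wide s) ?undup_uniq//;
  try by move=> m; rewrite mem_undup !mem_cat => ->; rewrite ?orbT.
rewrite mulr_sumr -big_split; apply: eq_bigr => m _ /=.
by rewrite mcoeffD mcoeffZ rmorphD rmorphM mulrDl mulrA.
Qed.

Lemma monomial_sumX m : monomial_sum 'X_[m] = g m.
Proof. by rewrite /monomial_sum msuppX big_seq1 mcoeffX eqxx rmorph1 mul1r. Qed.

Lemma monomial_sum0 : monomial_sum 0 = 0.
Proof. by rewrite /monomial_sum msupp0 big_nil. Qed.

Lemma monomial_sumE (s : seq 'X_{1..n}) (a : 'X_{1..n} -> R) (h : 'X_{1..n} -> 'X_{1..n}) :
  monomial_sum (\sum_(m <- s) a m *: 'X_[h m]) = \sum_(m <- s) kappa (a m) * g (h m).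
Proof.
elim: s => [|m s IHs]; first by rewrite !big_nil monomial_sum0.
by rewrite !big_cons monomial_sum_linear monomial_sumX IHs.
Qed.

Lemma monomial_sumMX k p (t : P) : (forall m, g (k + m)%MM = t * g m) ->
  monomial_sum ('X_[k] * p) = t * monomial_sum p.
Proof.
move=> gk; rewrite {1}[p]mpolyE mulr_sumr.
under eq_bigr => m _ do rewrite -scalerAr -mpolyXD.
rewrite monomial_sumE /monomial_sum mulr_sumr.
by apply: eq_bigr => m _; rewrite gk mulrCA.
Qed.

End MonomialSum.

Section VeroneseMonomials.
Variables (R : comNzRingType) (n d : nat).
Notation V := (veronese R n d).

Lemma submonomial (m : 'X_{1..n}) k : (k <= mdeg m)%N ->
  exists m1, (m1 <= m)%MM /\ mdeg m1 = k.
Proof.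
elim: k => [_|k IHk km].
  by exists 0%MM; rewrite mdeg0; split=> //; apply/mnm_lepP => i; rewrite mnm0E.
have [m1 [m1m m1k]] := IHk (ltnW km).
have [i mi] : exists i, (m1 i < m i)%N.
  apply: contrapT => /forallNP no_i; move: km.
  by rewrite -m1k !mdegE ltnNge leq_sum// => i _; rewrite leqNgt; apply/negP/no_i.
exists (m1 + U_(i))%MM; rewrite mdegD mdeg1 m1k addn1; split=> //.
apply/mnm_lepP => j; rewrite mnmDE mnm1E; case: eqP => [<-|_]; first by rewrite addn1.
by rewrite addn0; move/mnm_lepP: m1m.
Qed.

(** A monomial whose degree is a positive multiple of [d] has a factor of degree
    [d]. *)
Lemma monomial_veronese (m : 'X_{1..n}) : (d %| mdeg m)%N ->
  'X_[m] \in @veronese_pred R n d.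
Proof.
move=> /dvdnP[k mk]; apply/asboolP => T [T1 _ TM] TX.
elim: k m mk => [|k IHk] m mk.
  have -> : m = 0%MM by apply/eqP; rewrite -mdeg_eq0 mk.
  by rewrite mpolyX0.
have [m1 [m1m m1d]] : exists m1, (m1 <= m)%MM /\ mdeg m1 = d.
  by apply: submonomial; rewrite mk mulSn leq_addr.
rewrite -(submK m1m) mpolyXD; apply: TM; last exact: TX.
apply: IHk; apply: (@addIn (mdeg m1)).
by rewrite -mdegD (submK m1m) mk m1d mulSn addnC.
Qed.

(** The polynomials supported in degrees divisible by [d] form a subalgebra. *)
Lemma veronese_support (p : {mpoly R[n]}) m : p \in @veronese_pred R n d ->
  m \in msupp p -> (d %| mdeg m)%N.
Proof.
move=> /asboolP pV; apply: contraLR => m_d.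
pose T : {pred {mpoly R[n]}} := fun p => `[< forall m, ~~ (d %| mdeg m)%N -> p@_m = 0 >].
suff /asboolP/(_ m m_d) p0 : p \in T by rewrite mcoeff_msupp p0 eqxx.
have TX k : (d %| mdeg k)%N -> 'X_[k] \in T.
  by move=> kd; apply/asboolP => l; rewrite mcoeffX; case: eqP => // <-; rewrite kd.
apply: pV => [|k kd]; last by apply: TX; rewrite kd.
split=> [|a u v /asboolP Tu /asboolP Tv|u v /asboolP Tu /asboolP Tv].
- by rewrite -mpolyX0; apply: TX; rewrite mdeg0 dvdn0.
- by apply/asboolP => k kd; rewrite mcoeffD mcoeffZ Tu// Tv// mulr0 addr0.
- apply/asboolP => k kd; rewrite mcoeffM big1// => -[k1 k2] /= /eqP kE.
  have [k1d|k1d] := boolP (d %| mdeg k1)%N; last by rewrite Tu// mul0r.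
  rewrite Tv ?mulr0//; apply: contra kd => k2d.
  by rewrite kE mdegD dvdn_add.
Qed.

Lemma const_veronese a : a%:MP_[n] \in @veronese_pred R n d.
Proof.
apply/asboolP => T [T1 TZ _] _.
rewrite -[a%:MP_[n]]mulr1 mul_mpolyC -[_ *: _]addr0.
by apply: (TZ) => //; rewrite -(subrr 1) -scaleN1r addrC; exact: TZ.
Qed.

Definition veronese_const (a : R) : V := exist _ a%:MP_[n] (const_veronese a).

Lemma veronese_const_zmod : zmod_morphism veronese_const.
Proof. by move=> a b; apply: val_inj; rewrite /= rmorphB. Qed.

Lemma veronese_const_monoid : monoid_morphism veronese_const.
Proof. by split=> [|a b]; apply: val_inj; rewrite /= ?rmorph1 ?rmorphM. Qed.

HB.instance Definition _ := GRing.isZmodMorphism.Build R V veronese_const veronese_const_zmod.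
HB.instance Definition _ := GRing.isMonoidMorphism.Build R V veronese_const veronese_const_monoid.

Definition veronese_monomial (m : 'X_{1..n}) : V :=
  if pselect (d %| mdeg m)%N is left md then exist _ 'X_[m] (monomial_veronese md) else 0.

Lemma veronese_monomialE m : (d %| mdeg m)%N -> val (veronese_monomial m) = 'X_[m].
Proof. by rewrite /veronese_monomial; case: pselect. Qed.

Definition var_power (i : nat) : V :=
  if insub i is Some j then veronese_monomial (U_(j : 'I_n) *+ d)%MM else 0.

Lemma mdegMn (m : 'X_{1..n}) k : mdeg (m *+ k)%MM = (k * mdeg m)%N.
Proof. by rewrite !mdegE big_distrr /=; apply: eq_bigr => i _; rewrite mulmnE mulnC. Qed.

Lemma val_var_power (i : 'I_n) : val (var_power i) = 'X_[U_(i) *+ d].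
Proof. by rewrite /var_power valK veronese_monomialE// mdegMn dvdn_mulr. Qed.

Definition veronese_param m : {rmorphism iterated_poly R m -> V} :=
  iterated_eval veronese_const var_power m.

Definition augmentation : {rmorphism V -> R} := meval (fun=> 0) \o val.

Lemma augmentation_const a : augmentation (veronese_const a) = a.
Proof. by rewrite /= mevalC. Qed.

Hypothesis d_gt0 : (0 < d)%N.

Lemma augmentation_var_power i : augmentation (var_power i) = 0.
Proof.
rewrite /var_power; case: insubP => [j _ _|_]; last by rewrite rmorph0.
rewrite /= veronese_monomialE ?mdegMn ?dvdn_mulr// mevalX (bigD1 j)//=.
by rewrite mulmnE mnm1E eqxx mul1n -[d]prednK// exprS !mul0r.
Qed.

(** Dividing all exponents by [d] with remainder writes a monomial as a product of
    powers of the [X_i^d] and of a monomial with exponents less than [d]. The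
    coordinate [lam j] collects the quotients for the remainder [j]. If the
    degree of the monomial is divisible by [d], so is that of its remainder,
    hence the generators [x j] with nonzero coordinates lie in the Veronese
    subring. *)
Theorem veronese_finite_projective : finite_projective (veronese_param n).
Proof.
pose J := {ffun 'I_n -> 'I_d}.
pose res (m : 'X_{1..n}) : J := [ffun i => Ordinal (ltn_pmod (m i) d_gt0)].
(* [mono m] is the quotient of the division by [d], [res m] the remainder. *)
pose mono (m : 'X_{1..n}) := \prod_(i < n) iterated_var R n i ^+ (m i %/ d).
pose g (j : J) m := if res m == j then mono m else 0.
pose x (j : J) : V := veronese_monomial [multinom (j i : nat) | i < n].
(* [x j] is zero when the remainder [j] has degree not divisible by [d]. *)
pose lam (j : J) (a : V) := monomial_sum (iterated_const R n) (g j) (val a).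
have lam_lin c j a b : lam j (veronese_const c * a + b) = iterated_const R n c * lam j a + lam j b.
  by rewrite /lam -monomial_sum_linear /= -mul_mpolyC.
have lamD j a b : lam j (a + b) = lam j a + lam j b.
  by rewrite -[a]mul1r -[X in X * a](rmorph1 veronese_const) lam_lin !rmorph1 !mul1r.
have lamM j p a : lam j (veronese_param n p * a) = p * lam j a.
  elim/iterated_poly_ind: p a => [c|i im|p q IHp IHq|p q IHp IHq] a.
  - rewrite /veronese_param iterated_eval_const -[_ * a]addr0 lam_lin.
    by rewrite [lam j 0]monomial_sum0 addr0.
  - have dE : val (var_power i) = 'X_[U_(Ordinal im) *+ d] := val_var_power (Ordinal im).
    rewrite /veronese_param iterated_eval_var// /lam rmorphM /= dE.
    apply: monomial_sumMX => m; rewrite /g.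
    have -> : res (U_(Ordinal im) *+ d + m)%MM = res m.
      apply/ffunP => k; rewrite !ffunE; apply: val_inj.
      by rewrite /= mnmDE mulmnE modnMDl.
    case: eqP => _; last by rewrite mulr0.
    rewrite /mono (bigD1 (Ordinal im))//= [in RHS](bigD1 (Ordinal im))//= mulrA -exprS.
    rewrite mnmDE mulmnE mnm1E eqxx divnMDl// add1n; congr (_ * _).
    apply: eq_bigr => k /negPf ki; rewrite mnmDE mulmnE mnm1E eq_sym ki.
    by rewrite mul0n add0n.
  - by rewrite rmorphD mulrDl lamD IHp IHq mulrDl.
  - by rewrite rmorphM -mulrA IHp IHq mulrA.
apply: (@finite_projectiveI _ _ _ J x lam) => [j p a b|a]; first by rewrite lamD lamM.
apply: val_inj.
pose psi : {rmorphism iterated_poly R n -> {mpoly R[n]}} := val \o veronese_param n.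
have psi_var (i : 'I_n) : psi (iterated_var R n i) = 'X_[U_(i) *+ d].
  by rewrite /= /veronese_param iterated_eval_var// val_var_power.
have psi_mono m : psi (mono m) = \prod_(i < n) 'X_[U_(i)] ^+ (d * (m i %/ d)).
  rewrite rmorph_prod; apply: eq_bigr => i _.
  by rewrite rmorphXn psi_var exprM mpolyXn.
have term (j : J) : val (veronese_param n (lam j a) * x j) =
    \sum_(m <- msupp (val a)) (val a)@_m *: (psi (g j m) * val (x j)).
  rewrite /lam /monomial_sum rmorphM !rmorph_sum mulr_suml; apply: eq_bigr => m _.
  rewrite !rmorphM /veronese_param iterated_eval_const /=.
  by rewrite mul_mpolyC scalerAl.
transitivity (\sum_j val (veronese_param n (lam j a) * x j)); last by rewrite rmorph_sum.
under eq_bigr => j _ do rewrite term.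
rewrite exchange_big [LHS]mpolyE big_seq [RHS]big_seq; apply: eq_bigr => m m_supp.
rewrite -scaler_sumr; congr (_ *: _).
rewrite (bigD1 (res m))// big1 ?addr0; last first.
  by move=> j /andP[_ /negPf jm]; rewrite /g eq_sym jm rmorph0 mul0r.
have rE : ([multinom (res m i : nat) | i < n] + [multinom (d * (m i %/ d))%N | i < n])%MM = m.
  by apply/mnmP => i; rewrite mnmDE !mnmE ffunE /= addnC mulnC -divn_eq.
have m_d := veronese_support (valP a) m_supp.
have r_d : (d %| mdeg [multinom (res m i : nat) | i < n])%N.
  move: m_d; rewrite -{1}rE mdegD dvdn_addl// mdegE.
  by apply: dvdn_sum => i _; rewrite mnmE dvdn_mulr.
have gE : g (res m) m = mono m by rewrite /g eqxx.
rewrite gE psi_mono veronese_monomialE//.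
have <- : 'X_[[multinom (d * (m i %/ d))%N | i < n]] =
    \prod_(i < n) 'X_[U_(i)] ^+ (d * (m i %/ d)) :> {mpoly R[n]}.
  by rewrite mpolyXE_id; apply: eq_bigr => i _; rewrite mnmE.
by rewrite mulrC -mpolyXD rE [RHS]addr0.
Qed.

End VeroneseMonomials.

(** * Regular sequences *)

Section IdealQuotient.
Variable A : comPzRingType.
Implicit Types (s : seq A) (a u : A).

Lemma quotient_map_zmod s : zmod_morphism (quotient_map s).
Proof.
by move=> a b; apply/eqP; rewrite eq_sym subr_eq eq_sym -quotient_mapD subrK.
Qed.

Lemma quotient_map_monoid s : monoid_morphism (quotient_map s).
Proof. by split; [exact: quotient_map1|exact: quotient_mapM]. Qed.

HB.instance Definition _ s :=
  GRing.isZmodMorphism.Build A (quotient_ring s) (quotient_map s) (quotient_map_zmod s).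
HB.instance Definition _ s :=
  GRing.isMonoidMorphism.Build A (quotient_ring s) (quotient_map s) (quotient_map_monoid s).

Lemma quotient_map_eq0 s u : quotient_map s u = 0 <-> u \in ideal_gen s.
Proof. by rewrite -(rmorph0 (quotient_map s)) (rwP eqP) eq_quotient_map subr0. Qed.

Lemma ideal_gen_nat s u :
  u \in ideal_gen s <-> exists c : nat -> A, u = \sum_(i < size s) c i * s`_i.
Proof.
split=> [/asboolP[c ->]|[c ->]]; last by apply/asboolP; exists (c \o val).
exists (fun i => if insub i is Some j then c j else 0).
by apply: eq_bigr => i _; rewrite valK.
Qed.

Lemma ideal_gen_nil u : u \in ideal_gen [::] <-> u = 0.
Proof.
split=> [/ideal_gen_nat[c ->]|->]; first by rewrite big_ord0.
by apply/ideal_gen_nat; exists (fun=> 0); rewrite big_ord0.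
Qed.

(** This and [quotient_rcons] allow inductions that extend a sequence on the
    right, as regular sequences require. *)
Lemma ideal_gen_rcons s a u :
  u \in ideal_gen (rcons s a) <-> exists v, u - a * v \in ideal_gen s.
Proof.
have rconsE (c : nat -> A) : \sum_(i < size (rcons s a)) c i * (rcons s a)`_i =
    \sum_(i < size s) c i * s`_i + a * c (size s).
  rewrite size_rcons big_ord_recr /= nth_rcons ltnn eqxx mulrC; congr (_ + _).
  by apply: eq_bigr => i _; rewrite nth_rcons ltn_ord.
split=> [/ideal_gen_nat[c ->]|[v /ideal_gen_nat[c uE]]].
  by exists (c (size s)); rewrite rconsE addrK; apply/ideal_gen_nat; exists c.
pose c' i := if i == size s then v else c i.
apply/ideal_gen_nat; exists c'; rewrite rconsE {2}/c' eqxx -[LHS](subrK (a * v)) uE.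
by congr (_ + _); apply: eq_bigr => i _; rewrite /c' ltn_eqF.
Qed.

Lemma ideal_gen1 s u : 1 \in ideal_gen s -> u \in ideal_gen s.
Proof. by move=> /(ideal_genMl u); rewrite mulr1. Qed.

Lemma quotient_rcons s a : exists pi : {rmorphism quotient_ring s -> quotient_ring (rcons s a)},
  [/\ forall u, pi (quotient_map s u) = quotient_map (rcons s a) u,
      forall x, exists y, pi y = x &
      forall y, pi y = 0 <-> exists v, y = quotient_map s a * v].
Proof.
have [lift liftK] := choice (@quotient_map_surj _ s).
pose pi y := quotient_map (rcons s a) (lift y).
have piE u : pi (quotient_map s u) = quotient_map (rcons s a) u.
  apply/eqP; rewrite eq_quotient_map; apply/ideal_gen_rcons; exists 0.
  by rewrite mulr0 subr0 -eq_quotient_map liftK.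
have pi_zmod : zmod_morphism pi.
  by move=> x y; rewrite -[x]liftK -[y]liftK -rmorphB !piE rmorphB.
have pi_monoid : monoid_morphism pi.
  split=> [|x y]; first by rewrite -(rmorph1 (quotient_map s)) piE rmorph1.
  by rewrite -[x]liftK -[y]liftK -rmorphM !piE rmorphM.
exists (ring_hom pi_zmod pi_monoid); split=> [u|x|y].
- exact: piE.
- have [u <-] := quotient_map_surj x; exists (quotient_map s u); exact: piE.
- rewrite -[ring_hom _ _ y]/(pi y) quotient_map_eq0 ideal_gen_rcons.
  split=> [[v]|[v]].
    rewrite -quotient_map_eq0 rmorphB /= liftK rmorphM => /eqP.
    by rewrite subr_eq0 => /eqP ->; exists (quotient_map s v).
  have [w <-] := quotient_map_surj v; rewrite -rmorphM => yE.
  exists w; rewrite -quotient_map_eq0 rmorphB /= liftK yE.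
  by rewrite -rmorphB subrr rmorph0.
Qed.

(** The second half of the definition of a regular sequence. *)
Definition weakly_regular s : Prop :=
  forall i, (i < size s)%N -> GRing.lreg (quotient_map (take i s) s`_i).

Lemma weakly_regular_rcons s a :
  weakly_regular (rcons s a) <-> weakly_regular s /\ GRing.lreg (quotient_map s a).
Proof.
have take_lt i : (i < size s)%N -> take i (rcons s a) = take i s.
  by move=> /ltnW is_; rewrite -cats1 takel_cat.
have take_all : take (size s) (rcons s a) = s by rewrite -cats1 take_size_cat.
split=> [sa_reg|[s_reg a_reg] i].
  split=> [i is_|].
    by have := sa_reg i; rewrite size_rcons take_lt// nth_rcons is_; apply; exact: ltnW.
  by have := sa_reg (size s); rewrite size_rcons take_all nth_rcons ltnn eqxx; apply.
rewrite size_rcons ltnS leq_eqVlt => /orP[/eqP->|is_].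
  by rewrite take_all nth_rcons ltnn eqxx.
by rewrite take_lt// nth_rcons is_; exact: s_reg.
Qed.

Lemma regular_sequence_rcons s a : regular_sequence (rcons s a) <->
  [/\ regular_sequence s, GRing.lreg (quotient_map s a) & 1 \notin ideal_gen (rcons s a)].
Proof.
split=> [[sa_proper /weakly_regular_rcons[s_reg a_reg]]|[[_ s_reg] a_reg sa1]].
  have [b bsa] : exists b, b \notin ideal_gen (rcons s a).
    by apply: sa_proper => /(congr1 size); rewrite size_rcons.
  split=> //; last by apply: contra bsa; exact: ideal_gen1.
  split=> // _; exists b; apply: contra bsa => bs; apply/ideal_gen_rcons; exists 0.
  by rewrite mulr0 subr0.
split; first by exists 1.
exact/weakly_regular_rcons.
Qed.

Lemma unit_mod_rcons s a : 1 \in ideal_gen (rcons s a) <->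
  exists v, quotient_map s a * v = 1.
Proof.
rewrite ideal_gen_rcons; split=> [[v]|[w]].
  rewrite -quotient_map_eq0 rmorphB rmorph1 rmorphM => /eqP.
  by rewrite subr_eq0 => /eqP->; exists (quotient_map s v).
have [v <-] := quotient_map_surj w => av; exists v.
by rewrite -quotient_map_eq0 rmorphB rmorph1 rmorphM av subrr.
Qed.

Lemma regular_sequence_proper s : 1 <> 0 :> A -> regular_sequence s ->
  1 <> 0 :> quotient_ring s.
Proof.
rewrite -(rmorph1 (quotient_map s)) => A1 [s_proper _] /quotient_map_eq0 s1.
have [s0|s0] := pselect (s = [::]).
  by move: s1; rewrite s0 => /ideal_gen_nil.
by have [b /negP] := s_proper s0; apply; exact: ideal_gen1.
Qed.

End IdealQuotient.

Lemma finite_projective_eq (P A : comPzRingType) (phi psi : {rmorphism P -> A}) :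
  phi =1 psi -> finite_projective phi -> finite_projective psi.
Proof.
move=> phi_psi [r [x [lam [lam_lin x_gen]]]]; exists r, x, lam.
split=> [i p a b|a]; first by rewrite -phi_psi lam_lin.
by rewrite [LHS]x_gen; apply: eq_bigr => i _; rewrite phi_psi.
Qed.

Lemma finite_projective_nil (P A : comPzRingType) (phi : {rmorphism P -> A}) :
  finite_projective phi ->
  finite_projective (quotient_map [::] \o phi : {rmorphism P -> quotient_ring [::]}).
Proof.
move=> [r [x [lam [lam_lin x_gen]]]].
have [lift liftK] := choice (@quotient_map_surj A [::]).
have q_inj : injective (@quotient_map A [::]).
  move=> u v /eqP; rewrite eq_quotient_map => /ideal_gen_nil/eqP.
  by rewrite subr_eq0 => /eqP.
exists r, (quotient_map [::] \o x), (fun i => lam i \o lift).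
split=> [i p a b|a] /=.
  rewrite -lam_lin; congr (lam i _); apply: q_inj.
  by rewrite liftK rmorphD rmorphM /= !liftK.
rewrite -[LHS]liftK [lift a in LHS]x_gen rmorph_sum.
by apply: eq_bigr => i _; rewrite rmorphM.
Qed.

Section OverPerfect.
Variables (R : comNzRingType) (n : nat) (A : comPzRingType).
Variable phi : {rmorphism iterated_poly R n -> A}.
Hypothesis Rdcc : principal_dcc R.
Hypothesis phi_fp : finite_projective phi.
Hypothesis A1 : 1 <> 0 :> A.

(** One variable is used up at each step. With no variable left, a further
    regular element would be a unit modulo [s], and the prolonged sequence would
    generate the unit ideal. *)
Lemma regular_sequence_quotient (s : seq A) : regular_sequence s ->
  exists m, (m + size s)%N = n /\
    exists psi : {rmorphism iterated_poly R m -> quotient_ring s}, finite_projective psi.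
Proof.
elim/last_ind: s => [_|s a IHs].
  by exists n; rewrite addn0; split=> //; eexists; exact: (finite_projective_nil phi_fp).
move=> /regular_sequence_rcons[/IHs[[|m] [mn [psi psi_fp]]] a_reg sa1].
  case/negP: sa1; apply/unit_mod_rcons.
  exact: regular_unit_over_dcc psi_fp a_reg.
exists m; rewrite size_rcons addnS; split=> //.
have [pi [_ pi_surj pi_ker]] := quotient_rcons s a.
apply: (finite_projective_regular_quotient _ _ psi_fp a_reg pi_surj pi_ker).
  exact: (@iterated_poly_primary R m.+1).
exact: iterated_poly_normalizable.
Qed.

Lemma maximal_regular_sequence_size (s : seq A) : maximal_regular_sequence s -> size s = n.
Proof.
move=> [s_reg s_max]; have [[|m] [mn [psi psi_fp]]] := regular_sequence_quotient s_reg.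
  by [].
have [a aE] := quotient_map_surj (psi 'X).
case: (s_max a); apply/regular_sequence_rcons; split=> //.
  rewrite aE; apply: finite_projective_regular => //.
  exact/monic_lreg/monicX.
apply/negP => /unit_mod_rcons[v]; rewrite aE => Xv.
exact: (regular_sequence_proper A1 s_reg (variable_nonunit psi_fp Xv)).
Qed.

Theorem n_subperfect_over_dcc : n_subperfect n A.
Proof.
split.
- move=> s s_reg; have [m [_ [psi psi_fp]]] := regular_sequence_quotient s_reg.
  apply/dcc_perfect/regular_dcc_quotient/(finite_projective_dcc _ psi_fp).
  exact: iterated_poly_primary.
- move=> s s_reg; have [k] : exists k, (n - size s <= k)%N by exists (n - size s)%N.
  elim: k s s_reg => [|k IHk] s s_reg nk;
    (have [s_max|] := pselect (maximal_regular_sequence s);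
      first by (exists [::]; rewrite cats0)).
    move=> s_not; have [a sa_reg] : exists a, regular_sequence (rcons s a).
      by apply: contrapT => /forallNP no_a; apply: s_not.
    have [m [mn _]] := regular_sequence_quotient sa_reg.
    by move: nk; rewrite -mn size_rcons addnS subSn ?leq_addl// .
  move=> s_not; have [a sa_reg] : exists a, regular_sequence (rcons s a).
    by apply: contrapT => /forallNP no_a; apply: s_not.
  have [|t t_max] := IHk _ sa_reg; first by rewrite size_rcons subnS -subn1 leq_subLR add1n.
  by exists (a :: t); rewrite -cat_rcons.
- exact: maximal_regular_sequence_size.
Qed.

End OverPerfect.

Section ParameterSequence.
Variables (R : comNzRingType) (A : comPzRingType) (c : {rmorphism R -> A}) (y : nat -> A).
Variable aug : {rmorphism A -> R}.
Hypothesis augK : forall r, aug (c r) = r.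
Hypothesis aug_y : forall i, aug (y i) = 0.
Variable n : nat.
Hypothesis param_fp : finite_projective (iterated_eval c y n).

(** The images of the variables, the last one first. The map [aug] stands for
    evaluation at the origin; it kills them, which shows that they generate a
    proper ideal. *)
Lemma parameter_sequence k : (k <= n)%N -> exists s : seq A,
  [/\ size s = k, regular_sequence s, forall u, u \in ideal_gen s -> aug u = 0 &
      finite_projective (quotient_map s \o iterated_eval c y (n - k)
        : {rmorphism iterated_poly R (n - k) -> quotient_ring s})].
Proof.
elim: k => [_|k IHk kn].
  exists [::]; split=> //; first by move=> u /ideal_gen_nil ->; rewrite rmorph0.
  by move: param_fp; rewrite -{1 2}[n]subn0; exact: finite_projective_nil.
have [s [sk s_reg s_aug s_fp]] := IHk (ltnW kn).
pose m := (n - k.+1)%N.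
have nk : (n - k)%N = m.+1 by rewrite /m -subSn.
move: s_fp; rewrite nk -/m => s_fp.
have sa_aug u : u \in ideal_gen (rcons s (y m)) -> aug u = 0.
  move=> /ideal_gen_rcons[v /s_aug/eqP].
  by rewrite rmorphB rmorphM aug_y mul0r subr0 => /eqP.
have XE : (quotient_map s \o iterated_eval c y m.+1) 'X = quotient_map s (y m).
  by rewrite /= poly_evalX.
exists (rcons s (y m)); split=> //; first by rewrite size_rcons sk.
  apply/regular_sequence_rcons; split=> //.
    by rewrite -XE; apply: finite_projective_regular => //; exact/monic_lreg/monicX.
  by apply/negP => /sa_aug/eqP; rewrite rmorph1 oner_eq0.
have [pi [piE pi_surj pi_ker]] := quotient_rcons s (y m).
have X1 : (quotient_map s \o iterated_eval c y m.+1) 'X = quotient_map s (y m) * 1.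
  by rewrite mulr1.
apply: finite_projective_eq (finite_projective_quotient (monicX _) X1 pi_surj pi_ker s_fp).
by move=> p; rewrite /= piE poly_evalC.
Qed.

(** Maximality of the sequence of parameters makes the regular elements of the
    quotient invertible, so a chain in the quotient which stabilizes after
    passing to fractions stabilizes in the quotient itself; it is then mapped
    to [R] by [aug]. *)
Theorem n_subperfect_dcc : n_subperfect n A -> principal_dcc R.
Proof.
move=> [A_sub A_ext A_max]; have [s [sn s_reg s_aug _]] := parameter_sequence (leqnn n).
have s_max : maximal_regular_sequence s.
  have [t t_max] := A_ext s s_reg; have := A_max _ t_max.
  rewrite size_cat sn -[RHS]addn0 => /addnI/size0nil t0.
  by rewrite -[s]cats0 -t0.
have s_unit (x : quotient_ring s) : GRing.lreg x -> exists v, x * v = 1.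
  have [a <-] := quotient_map_surj x => a_reg; apply/unit_mod_rcons.
  apply: contrapT => sa1; apply: (s_max.2 a); apply/regular_sequence_rcons.
  by split=> //; exact/negP.
move=> r; pose x i := quotient_map s (c (r i)).
have [N NP] := perfect_dcc (A_sub s s_reg) (fun i => to_quotient (x i)).
exists N => k; have [q] := NP k; rewrite -!rmorph_prod.
have [b [t [/s_unit[v tv] qt]]] := quotient_fraction q.
have -> : q = to_quotient (b * v) by rewrite rmorphM /= -qt -mulrA -rmorphM tv rmorph1 mulr1.
have [u <-] := quotient_map_surj (b * v).
rewrite -rmorphM => /to_quotient_inj; rewrite -rmorphM => /eqP.
rewrite eq_quotient_map => /s_aug/eqP; rewrite rmorphB rmorphM !augK subr_eq0 => /eqP.
by exists (aug u).
Qed.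

End ParameterSequence.

Theorem theorem8p3 (R : comNzRingType) (n d : nat) (d_gt0 : (0 < d)%N) :
  n_subperfect n (veronese R n d) <-> perfect R.
Proof.
have V_fp := veronese_finite_projective R n d_gt0.
split=> [|/perfect_dcc Rdcc].
  move=> /(n_subperfect_dcc (@augmentation_const R n d) (@augmentation_var_power R n d d_gt0) V_fp).
  exact: dcc_perfect.
apply: (n_subperfect_over_dcc Rdcc V_fp) => V1.
have := congr1 (@augmentation R n d) V1; rewrite rmorph1 rmorph0 => /eqP.
by rewrite oner_eq0.
Qed.
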